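(* Let $X_1=\mathbb{H}^3$ with its Riemannian metric of constant sectional curvature $-1$, and let $X_2=\mathbb{G}$ be the space of oriented geodesics of $\mathbb{H}^3$ with its $PSL(2,\mathbb{C})$-invariant holomorphic Riemannian metric $\langle\cdot,\cdot\rangle_{\mathbb{G}}$ of constant sectional curvature $-1$. Fix $x_1\in X_1$ and $x_2\in X_2$, let $\beta_i\colon PSL(2,\mathbb{C})\to X_i$, $\beta_i(A)=A\cdot x_i$, let $\mathfrak{sl}(2,\mathbb{C})=\mathfrak{h}_i\oplus\mathfrak{m}_i$ be the Cartan decomposition induced by the marked symmetric space $(X_i,x_i)$, and let $\mathcal{D}_i$ be the distribution on $PSL(2,\mathbb{C})$ given by $\mathcal{D}_i(A)=(L_A)_*\mathfrak{m}_i\subset T_A PSL(2,\mathbb{C})$. Let $\langle\cdot,\cdot\rangle$ be the holomorphic Riemannian metric on $PSL(2,\mathbb{C})$ equal to the left translate of $\frac18\mathrm{Kill}$. Then, for both $i=1,2$ and for all $A\in PSL(2,\mathbb{C})$, the restriction of the differential of $\beta_i$ at $A$ to $\mathcal{D}_i(A)$, \[d_A\beta_i\colon \big(\mathcal{D}_i(A),\,4\langle\cdot,\cdot\rangle\big)\xrightarrow{\ \sim\ } T_{A\cdot x_i}X_i,\] is a linear isometry, where $T_{A\cdot x_i}X_i$ carries the metric of $X_i$.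
   Context: Holomorphic Riemannian metric: on a complex manifold $\mathbb{M}$ with complex structure $\mathbb{J}$, a symmetric complex-valued $(0,2)$-tensor $\langle\cdot,\cdot\rangle$ on $T\mathbb{M}$ which is $\mathbb{C}$-bilinear ($\langle \mathbb{J}X,Y\rangle=\langle X,\mathbb{J}Y\rangle=i\langle X,Y\rangle$), pointwise non-degenerate, and such that $\langle X,Y\rangle$ is holomorphic for all local holomorphic vector fields $X,Y$. Write $\|X\|^2:=\langle X,X\rangle$. It has a unique torsion-free metric connection $D$, with curvature $R(X,Y)Z=D_XD_YZ-D_YD_XZ-D_{[X,Y]}Z$, and the sectional curvature of a complex $2$-plane $\mathrm{Span}_{\mathbb{C}}(V,W)$ on which the metric is non-degenerate is $\langle R(V,W)W,V\rangle/(\|V\|^2\|W\|^2-\langle V,W\rangle^2)$. Metric on $PSL(2,\mathbb{C})$: with $\mathfrak{sl}(2,\mathbb{C})$ the trace-free complex $2\times2$ matrices, $\mathrm{Kill}(M,N)=4\,\mathrm{tr}(MN)$, set $\langle\cdot,\cdot\rangle_A=\frac18(L_A)_*\mathrm{Kill}$, where $L_A$ is left translation by $A$; at the identity, $\langle M,N\rangle=\frac12\mathrm{tr}(MN)$. The spaces: $PSL(2,\mathbb{C})$ acts on $\mathbb{H}^3$ through the canonical identification $PSL(2,\mathbb{C})\cong \mathrm{Isom}_0(\mathbb{H}^3)$, which in the half-space model extends to the action on $\partial\mathbb{H}^3\cong\overline{\mathbb{C}}=\mathbb{CP}^1$ by Möbius transformations. The space of oriented (maximal, non-constant, unparametrized)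 geodesics of $\mathbb{H}^3$ is $\mathbb{G}=\partial\mathbb{H}^3\times\partial\mathbb{H}^3\setminus\Delta$ ($\Delta$ the diagonal; a geodesic is identified with the ordered pair of its endpoints), with the complex structure inherited from $\mathbb{CP}^1\times\mathbb{CP}^1$ and the diagonal action $A\cdot(z_1,z_2)=(Az_1,Az_2)$. The metric $\langle\cdot,\cdot\rangle_{\mathbb{G}}$ is the unique $PSL(2,\mathbb{C})$-invariant holomorphic Riemannian metric on $\mathbb{G}$ of constant sectional curvature $-1$; for every affine chart $(U,z)$ of $\mathbb{CP}^1$ it is given on $U\times U\setminus\Delta$ by $-\frac{4}{(z_1-z_2)^2}\,dz_1\,dz_2$, where $dz_1\,dz_2$ is the symmetric product $\frac12(dz_1\otimes dz_2+dz_2\otimes dz_1)$. Symmetric space structure and Cartan decompositions: the symmetry $s_1$ of $\mathbb{H}^3$ at $x_1$ is the geodesic (central) symmetry fixing $x_1$ (the map $\underline{x}\mapsto-\underline{x}$ in the disk model when $x_1=0$); the symmetry $s_2$ of $\mathbb{G}$ at $x_2$ is the one given by the rotation of angle $\pi$ around the geodesic $x_2$. Conjugation by $s_i$ is an involutive automorphism of $PSL(2,\mathbb{C})$; $\mathfrak{h}_i$ and $\mathfrak{m}_i$ are respectively the $+1$ and $-1$ eigenspaces of its differential on $\mathfrak{sl}(2,\mathbb{C})$, and $\mathfrak{h}_i$ is the Lie algebra of the stabilizer of $x_i$. For the base point $x_1$ with stabilizer $SU(2)/\{\pm I_2\}$ one has $\mathfrak{h}_1=\mathfrak{su}(2)$,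 $\mathfrak{m}_1=i\,\mathfrak{su}(2)$ (real subspaces); for the base point $x_2$ equal to the geodesic with endpoints $(i,-i)$, whose stabilizer is $SO(2,\mathbb{C})/\{\pm I_2\}$, one has $\mathfrak{h}_2=\mathfrak{o}(2,\mathbb{C})$ and $\mathfrak{m}_2=\mathrm{Sym}(2,\mathbb{C})\cap\mathfrak{sl}(2,\mathbb{C})$ (complex subspaces). For $i=1$ ''linear isometry'' means $\mathbb{R}$-linear isomorphism, and for $i=2$ $\mathbb{C}$-linear isomorphism, carrying $4\langle\cdot,\cdot\rangle$ restricted to $\mathcal{D}_i(A)$ to the metric of $X_i$ at $A\cdot x_i$. *)

(* Defs.v *)
From HB Require Import structures.
From mathcomp Require Import all_boot all_order all_algebra.
From mathcomp Require Import generic_quotient.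
From mathcomp Require Import complex.
From mathcomp Require Import boolp classical_sets functions reals topology.
From mathcomp Require Import normedtype derive.
From mathcomp Require Import ring lra.

Set Implicit Arguments.
Unset Strict Implicit.
Unset Printing Implicit Defensive.

Import Order.TTheory GRing.Theory Num.Theory.
Import numFieldNormedType.Exports.

Local Open Scope classical_set_scope.
Local Open Scope complex_scope.
Local Open Scope ring_scope.
Local Open Scope quotient_scope.

Lemma det_mx22 (K : comNzRingType) (A : 'M[K]_2) :
  \det A = A 0 0 * A 1 1 - A 0 1 * A 1 0.
Proof.
rewrite (expand_det_row A 0) !big_ord_recl big_ord0 addr0 /cofactor !det_mx11.
rewrite !mxE /= expr0 expr1 mul1r mulN1r mulrN.
by congr (A _ _ * A _ _ - A _ _ * A _ _); apply: val_inj.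
Qed.

Definition SL2 (R : realType) := {A : 'M[R[i]]_2 | \det A == 1}.

Definition sl2_eqv (R : realType) (A B : SL2 R) : bool :=
  (val A == val B) || (val A == - val B).

Lemma sl2_eqv_equiv (R : realType) : equiv_class_of (@sl2_eqv R).
Proof.
split.
- by move=> A; rewrite /sl2_eqv eqxx.
- by move=> A B; rewrite /sl2_eqv eq_sym [val A == - _]eq_sym eqr_oppLR.
- move=> B A C; rewrite /sl2_eqv => /orP[]/eqP-> /orP[]/eqP->;
  by rewrite ?opprK eqxx ?orbT.
Qed.

Canonical sl2_equiv (R : realType) := EquivRelPack (sl2_eqv_equiv R).

Definition PSL2 (R : realType) := {eq_quot (sl2_equiv R)}.

Lemma det_sl2_id (R : realType) : \det (1%:M : 'M[R[i]]_2) == 1.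
Proof. by rewrite det1. Qed.

Definition sl2_id (R : realType) : SL2 R := exist _ 1%:M (det_sl2_id R).

Lemma sl2_unit (R : realType) (A : SL2 R) : val A \in unitmx.
Proof. by rewrite unitmxE (eqP (valP A)) unitr1. Qed.

Lemma repr_pi (R : realType) (A : SL2 R) :
  val (repr (\pi_(PSL2 R) A)) = val A \/
  val (repr (\pi_(PSL2 R) A)) = - val A.
Proof.
have /eqmodP : repr (\pi_(PSL2 R) A) = A %[mod PSL2 R] by rewrite reprK.
by rewrite /= /sl2_eqv => /orP[]/eqP->; [left|right].
Qed.

Definition is_cderive (R : realType) (f : R -> R[i]) (w : R[i]) : Prop :=
  is_derive (0 : R) 1 (fun t => complex.Re (f t)) (complex.Re w) /\
  is_derive (0 : R) 1 (fun t => complex.Im (f t)) (complex.Im w).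

(* The curve is seen in the ambient space of 2 x 2 matrices, so the tangent
   space of SL(2,C) at A is the space of all A M with M trace-free. *)
Definition sl2_velocity (R : realType) (gam : R -> SL2 R) (V : 'M[R[i]]_2) :
  Prop := forall i j, is_cderive (fun t => val (gam t) i j) (V i j).

Definition Kill (R : realType) (M N : 'M[R[i]]_2) : R[i] := 4 * \tr (M *m N).

Definition sl2_metric (R : realType) (A : SL2 R) (V W : 'M[R[i]]_2) : R[i] :=
  8^-1 * Kill (invmx (val A) *m V) (invmx (val A) *m W).

Definition H3 (R : realType) := {x : R[i] * R | 0 < x.2}.

Definition normsq (R : realType) (w : R[i]) : R :=
  complex.Re w ^+ 2 + complex.Im w ^+ 2.

Lemma normsq_ge0 (R : realType) (w : R[i]) : 0 <= normsq w.
Proof. by rewrite addr_ge0 ?sqr_ge0. Qed.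

Lemma normsq_eq0 (R : realType) (w : R[i]) : (normsq w == 0) = (w == 0).
Proof.
by case: w => a b; rewrite /normsq eq_complex /= paddr_eq0 ?sqr_ge0 //
  !sqrf_eq0.
Qed.

Lemma normsqN (R : realType) (w : R[i]) : normsq (- w) = normsq w.
Proof. by case: w => a b; rewrite /normsq /= !sqrrN. Qed.

(* The conformal metric (|dz|^2 + dt^2) / t^2 at x = (z, t). The half-space is
   open in C x R, which is therefore its tangent space at every point. *)
Definition h3_metric (R : realType) (x : H3 R) (u v : R[i] * R) : R :=
  (complex.Re (u.1 * v.1^*) + u.2 * v.2) / (val x).2 ^+ 2.

Definition h3_velocity (R : realType) (gam : R -> H3 R) (u : R[i] * R) : Prop :=
  is_cderive (fun t => (val (gam t)).1) u.1 /\
  is_derive (0 : R) 1 (fun t => (val (gam t)).2) u.2.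

(* Poincare extension of a Moebius transformation: in quaternionic notation
   q = z + t j, it is q |-> (a q + b) (c q + d)^-1. *)
Definition poincare_den (R : realType) (A : 'M[R[i]]_2) (x : R[i] * R) : R :=
  normsq (A 1 0 * x.1 + A 1 1) + normsq (A 1 0) * x.2 ^+ 2.

Definition poincare_ext (R : realType) (A : 'M[R[i]]_2) (x : R[i] * R) :
    R[i] * R :=
  (((A 0 0 * x.1 + A 0 1) * (A 1 0 * x.1 + A 1 1)^* +
    A 0 0 * (A 1 0)^* * (x.2 ^+ 2)%:C) / (poincare_den A x)%:C,
   x.2 / poincare_den A x).

Lemma poincare_den_gt0 (R : realType) (A : SL2 R) (x : H3 R) :
  0 < poincare_den (val A) (val x).
Proof.
case: A x => A /= /eqP dA [[z t] /= t0]; rewrite /poincare_den /=.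
have t20 : 0 < t ^+ 2 by rewrite exprn_gt0.
have ct0 : 0 <= normsq (A 1 0) * t ^+ 2.
  by rewrite mulr_ge0 ?normsq_ge0 ?(ltW t20).
rewrite lt0r (addr_ge0 (normsq_ge0 _) ct0) andbT.
rewrite (paddr_eq0 (normsq_ge0 _) ct0).
rewrite mulf_eq0 (gt_eqF t20) orbF !normsq_eq0.
apply/negP => /andP[+ /eqP c0]; rewrite c0 mul0r add0r => /eqP d0.
by move/eqP: dA; rewrite det_mx22 c0 d0 !mulr0 subr0 eq_sym oner_eq0.
Qed.

Lemma poincare_ext_gt0 (R : realType) (A : SL2 R) (x : H3 R) :
  0 < (poincare_ext (val A) (val x)).2.
Proof. by rewrite divr_gt0 ?poincare_den_gt0 //; exact: (valP x). Qed.

Definition h3_act (R : realType) (a : PSL2 R) (x : H3 R) : H3 R :=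
  exist _ (poincare_ext (val (repr a)) (val x))
    (poincare_ext_gt0 (repr a) x).

Lemma poincare_extN (R : realType) (A : 'M[R[i]]_2) (x : R[i] * R) :
  poincare_ext (- A) x = poincare_ext A x.
Proof.
have E : poincare_den (- A) x = poincare_den A x.
  by rewrite /poincare_den !mxE mulNr -opprD !normsqN.
rewrite /poincare_ext E !mxE !mulNr -!opprD !rmorphN /=.
by rewrite !mulrN !mulNr !opprK.
Qed.

Lemma val_h3_act (R : realType) (A : SL2 R) (x : H3 R) :
  val (h3_act (\pi A) x) = poincare_ext (val A) (val x).
Proof. by rewrite /=; case: (repr_pi A) => ->; rewrite ?poincare_extN. Qed.

(* Geodesic symmetry at (z0, t0). At (0, 1) it is (z, t) |-> (- z, t) divided
   by |z|^2 + t^2, i.e. the map - id of the disk model centred there; the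
   general case follows by conjugating with the isometry
   (z, t) |-> (z0 + t0 z, t0 t). *)
Definition geod_symm (R : realType) (x y : R[i] * R) : R[i] * R :=
  let r := normsq (y.1 - x.1) + y.2 ^+ 2 in
  (x.1 - (x.2 ^+ 2 / r)%:C * (y.1 - x.1), x.2 ^+ 2 * y.2 / r).

Lemma geod_symm_gt0 (R : realType) (x y : H3 R) :
  0 < (geod_symm (val x) (val y)).2.
Proof.
have := valP x; have := valP y; rewrite /geod_symm /= => y0 x0.
by rewrite divr_gt0 ?mulr_gt0 ?exprn_gt0 // ltr_wpDl ?normsq_ge0 ?exprn_gt0.
Qed.

Definition h3_symm (R : realType) (x y : H3 R) : H3 R :=
  exist _ (geod_symm (val x) (val y)) (geod_symm_gt0 x y).

Definition CP1 (R : realType) := {l : {vspace 'cV[R[i]]_2} | \dim l == 1%N}.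

Lemma mx_lker0 (R : realType) (A : SL2 R) (U : {vspace 'cV[R[i]]_2}) :
  (U :&: lker (linfun (mulmx (val A)) : 'Hom('cV[R[i]]_2, 'cV[R[i]]_2)) = 0)%VS.
Proof.
apply/eqP; rewrite -subv0; apply/subvP => v /memv_capP[_].
rewrite memv_ker lfunE /= memv0 => /eqP Av0.
by rewrite -[v](mulKmx (sl2_unit A)) Av0 mulmx0.
Qed.

Lemma cp1_act_subproof (R : realType) (A : SL2 R) (l : CP1 R) :
  \dim (linfun (mulmx (val A)) @: val l)%VS == 1%N.
Proof. by rewrite (limg_dim_eq (mx_lker0 A (val l))); exact: (valP l). Qed.

Definition cp1_act (R : realType) (a : PSL2 R) (l : CP1 R) : CP1 R :=
  exist _ (linfun (mulmx (val (repr a))) @: val l)%VS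
    (cp1_act_subproof (repr a) l).

Lemma val_cp1_act (R : realType) (A : SL2 R) (l : CP1 R) :
  val (cp1_act (\pi A) l) = (linfun (mulmx (val A)) @: val l)%VS.
Proof.
rewrite /=; case: (repr_pi A) => -> //.
apply/vspaceP => v; apply/memv_imgP/memv_imgP => -[u ul ->];
  by exists (- u); rewrite ?memvN // !lfunE /= mulNmx mulmxN ?opprK.
Qed.

Lemma cp1_act_inj (R : realType) (a : PSL2 R) : injective (cp1_act a).
Proof.
move=> l m /(congr1 val) /= /vspaceP E; apply/val_inj/vspaceP => v.
have imE (U : {vspace 'cV[R[i]]_2}) :
    (mulmx (val (repr a)) v \in (linfun (mulmx (val (repr a))) @: U)%VS)
      = (v \in U).
  apply/memv_imgP/idP => [[u uU]|vU]; last by exists v; rewrite ?lfunE.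
  rewrite lfunE /= => /(congr1 (mulmx (invmx (val (repr a))))).
  by rewrite !mulKmx ?sl2_unit // => ->.
by rewrite -!imE E.
Qed.

Definition Geod (R : realType) := {x : CP1 R * CP1 R | x.1 != x.2}.

Lemma geod_act_subproof (R : realType) (a : PSL2 R) (x : Geod R) :
  cp1_act a (val x).1 != cp1_act a (val x).2.
Proof. by rewrite (inj_eq (@cp1_act_inj _ _)); exact: (valP x). Qed.

Definition geod_act (R : realType) (a : PSL2 R) (x : Geod R) : Geod R :=
  exist (fun y : CP1 R * CP1 R => y.1 != y.2)
    (cp1_act a (val x).1, cp1_act a (val x).2) (geod_act_subproof a x).

(* Affine charts (U, z) of CP^1 are indexed by invertible matrices P: U is the
   complement of one point and z [v] = (P v)_0 / (P v)_1. For P = 1 this is the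
   usual coordinate, in which A acts by z |-> (a z + b) / (c z + d). *)
Definition chart_dom (R : realType) (P : 'M[R[i]]_2) (l : CP1 R) : bool :=
  (P *m vpick (val l)) 1 0 != 0.

Definition chart (R : realType) (P : 'M[R[i]]_2) (l : CP1 R) : R[i] :=
  (P *m vpick (val l)) 0 0 / (P *m vpick (val l)) 1 0.

(* The atlas of all U x U minus the diagonal covers Geod, since any two points
   of CP^1 lie in a common affine chart. In each of these charts the tangent
   space is C x C. *)
Definition geod_dom (R : realType) (P : 'M[R[i]]_2) (x : Geod R) : bool :=
  chart_dom P (val x).1 && chart_dom P (val x).2.

(* - 4 / (z1 - z2)^2 dz1 dz2, with dz1 dz2 = 1/2 (dz1 (x) dz2 + dz2 (x) dz1) *)
Definition geod_metric (R : realType) (P : 'M[R[i]]_2) (x : Geod R)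
    (u v : R[i] * R[i]) : R[i] :=
  - (4 / (chart P (val x).1 - chart P (val x).2) ^+ 2) *
  (2^-1 * (u.1 * v.2 + u.2 * v.1)).

Definition geod_velocity (R : realType) (P : 'M[R[i]]_2) (gam : R -> Geod R)
    (u : R[i] * R[i]) : Prop :=
  [/\ \forall t \near (0 : R), geod_dom P (gam t),
      is_cderive (fun t => chart P (val (gam t)).1) u.1 &
      is_cderive (fun t => chart P (val (gam t)).2) u.2].

(* The rotation of angle pi around the geodesic x: it fixes the endpoints, and
   a matrix for it has eigenvalues i and - i on them. *)
Definition endpoints_mx (R : realType) (x : Geod R) : 'M[R[i]]_2 :=
  row_mx (vpick (val (val x).1)) (vpick (val (val x).2)).

Definition half_turn_mx (R : realType) (x : Geod R) : 'M[R[i]]_2 :=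
  endpoints_mx x *m diag_mx (\row_j (if j == 0 then 'i else - 'i)) *m
  invmx (endpoints_mx x).

Lemma cp1_vline (R : realType) (l : CP1 R) (v : 'cV[R[i]]_2) :
  v != 0 -> v \in val l -> val l = <[v]>%VS.
Proof.
move=> v0 vl; apply/esym/eqP; rewrite eqEdim -memvE vl /=.
by rewrite (eqP (valP l)) dim_vline v0.
Qed.

Lemma vpick_cp1_neq0 (R : realType) (l : CP1 R) : vpick (val l) != 0.
Proof. by rewrite vpick0 -dimv_eq0 (eqP (valP l)). Qed.

Lemma endpoints_mx_unit (R : realType) (x : Geod R) :
  endpoints_mx x \in unitmx.
Proof.
case: x => -[l m] /= lm; rewrite unitmxE unitfE /endpoints_mx /=.
set v := vpick (val l); set w := vpick (val m).
have v0 : v != 0 := vpick_cp1_neq0 l.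
have w0 : w != 0 := vpick_cp1_neq0 m.
apply: contra lm => /eqP dP.
have {}dP : v 0 0 * w 1 0 = w 0 0 * v 1 0.
  have E0 i : (row_mx v w : 'M_2) i 0 = v i 0.
    by rewrite -(row_mxEl v w); congr (row_mx v w _ _); apply: val_inj.
  have E1 i : (row_mx v w : 'M_2) i 1 = w i 0.
    by rewrite -(row_mxEr v w); congr (row_mx v w _ _); apply: val_inj.
  by move: dP; rewrite det_mx22 !E0 !E1 => /eqP; rewrite subr_eq0 => /eqP.
have [i vi0] : exists i, v i 0 != 0.
  apply/existsP; apply: contraNT v0; rewrite negb_exists => /forallP v0.
  by apply/eqP/colP => i; rewrite mxE; apply/eqP; rewrite -[_ == _]negbK v0.
have wE : v i 0 *: w = w i 0 *: v.
  have I2 (k : 'I_2) : k = 0 \/ k = 1.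
    by case: k => [[|[|//]] ?]; [left|right]; apply: val_inj.
  apply/colP => j; rewrite !mxE.
  case: (I2 i) => ->; case: (I2 j) => ->; first by rewrite mulrC.
  - exact: dP.
  - by rewrite mulrC -dP mulrC.
  - by rewrite mulrC.
have {}wE : w = (w i 0 / v i 0) *: v.
  by rewrite mulrC -scalerA -wE scalerA mulVf // scale1r.
have wl : w \in val l by rewrite wE memvZ // memv_pick.
apply/eqP/val_inj; rewrite /= (cp1_vline w0 wl).
by rewrite (cp1_vline w0 (memv_pick _)).
Qed.

Lemma det_half_turn_mx (R : realType) (x : Geod R) :
  \det (half_turn_mx x) == 1.
Proof.
rewrite /half_turn_mx !det_mulmx det_inv mulrAC divff ?mul1r; last first.
  by rewrite -unitfE -unitmxE endpoints_mx_unit.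
rewrite det_diag big_ord_recl big_ord1 !mxE /=.
by apply/eqP; apply/eqP; rewrite eq_complex /=; apply/andP; split;
  apply/eqP; ring.
Qed.

Definition half_turn (R : realType) (x : Geod R) : PSL2 R :=
  \pi_(PSL2 R) (exist (fun S : 'M[R[i]]_2 => \det S == 1)
    (half_turn_mx x) (det_half_turn_mx x)).

Definition geod_symmetry (R : realType) (x y : Geod R) : Geod R :=
  geod_act (half_turn x) y.

(* b is the conjugate of a by s, both seen as transformations of X (s is a
   symmetry, hence its own inverse). *)
Definition is_conj (R : realType) (X : Type) (act : PSL2 R -> X -> X)
    (s : X -> X) (a b : PSL2 R) : Prop :=
  forall y, act b y = s (act a (s y)).

(* N is the image of M under the differential at the identity of the
   conjugation by s: it is the velocity of the conjugate of a curve with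
   velocity M. Both curves are lifted to SL(2,C). *)
Definition is_dconj (R : realType) (X : Type) (act : PSL2 R -> X -> X)
    (s : X -> X) (M N : 'M[R[i]]_2) : Prop :=
  exists gam eta : R -> SL2 R,
    [/\ gam 0 = sl2_id R, sl2_velocity gam M,
        eta 0 = sl2_id R, sl2_velocity eta N &
        forall t, is_conj act s (\pi_(PSL2 R) (gam t)) (\pi_(PSL2 R) (eta t))].

Definition cartan_eigenspace (R : realType) (X : Type)
    (act : PSL2 R -> X -> X) (s : X -> X) (e : R[i]) : set 'M[R[i]]_2 :=
  [set M | \tr M = 0 /\ is_dconj act s M (e *: M)].

Definition cartan_h (R : realType) (X : Type)
    (act : PSL2 R -> X -> X) (s : X -> X) := cartan_eigenspace act s 1.

Definition cartan_m (R : realType) (X : Type)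
    (act : PSL2 R -> X -> X) (s : X -> X) := cartan_eigenspace act s (- 1).

Definition left_translate (R : realType) (A : SL2 R) (m : set 'M[R[i]]_2) :
  set 'M[R[i]]_2 := [set val A *m M | M in m].

Definition D1 (R : realType) (x : H3 R) (A : SL2 R) : set 'M[R[i]]_2 :=
  left_translate A (cartan_m (@h3_act R) (h3_symm x)).

Definition D2 (R : realType) (x : Geod R) (A : SL2 R) : set 'M[R[i]]_2 :=
  left_translate A (cartan_m (@geod_act R) (geod_symmetry x)).

(* The projection of SL(2,C) onto PSL(2,C) is a covering, so it identifies the
   tangent space of PSL(2,C) at the class of A with that of SL(2,C) at A. The
   differential of f at the class of A is read through this identification and
   characterized by its values on velocities of curves. *)
Definition is_differential (R : realType) (X T : Type)
    (velocity : (R -> X) -> T -> Prop) (f : PSL2 R -> X) (A : SL2 R)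
    (L : 'M[R[i]]_2 -> T) : Prop :=
  forall (gam : R -> SL2 R) (V : 'M[R[i]]_2), gam 0 = A ->
    sl2_velocity gam V -> velocity (fun t => f (\pi_(PSL2 R) (gam t))) (L V).

Definition real_linear_isometry (R : realType) (D : set 'M[R[i]]_2)
    (q : 'M[R[i]]_2 -> 'M[R[i]]_2 -> R[i])
    (g : R[i] * R -> R[i] * R -> R) (L : 'M[R[i]]_2 -> R[i] * R) : Prop :=
  [/\ set_bij D setT L,
      forall (k : R) V W, D V -> D W ->
        L (k%:C *: V + W) =
        (k%:C * (L V).1 + (L W).1, k * (L V).2 + (L W).2) &
      forall V W, D V -> D W -> (g (L V) (L W))%:C = q V W].

Definition complex_linear_isometry (R : realType) (D : set 'M[R[i]]_2)
    (q : 'M[R[i]]_2 -> 'M[R[i]]_2 -> R[i])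
    (g : R[i] * R[i] -> R[i] * R[i] -> R[i])
    (L : 'M[R[i]]_2 -> R[i] * R[i]) : Prop :=
  [/\ set_bij D setT L,
      forall (k : R[i]) V W, D V -> D W ->
        L (k *: V + W) =
        (k * (L V).1 + (L W).1, k * (L V).2 + (L W).2) &
      forall V W, D V -> D W -> g (L V) (L W) = q V W].

(* Main.v *)
(** The half-space is modelled by the Hermitian matrices of determinant 1 and
    positive trace, on which A acts by Y |-> A Y A^*. The geodesic symmetry at X
    is Y |-> X Y^-1 X, so conjugation by it is A |-> X (A^* )^-1 X^-1 and m_1
    consists of the trace-free M with M X Hermitian. The orbit map A |-> A X A^*
    has differential A M |-> 2 A M X A^* on D_1, and in this model the
    hyperbolic metric at Y is 1/2 tr (Y^-1 H Y^-1 K).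

    For geodesics, let E be the matrix whose columns represent the endpoints.
    Then m_2 consists of the M for which E^-1 M E is antidiagonal, and in the
    affine chart P the endpoints of A x are the ratios of the columns of P A E.

    Both descriptions of m_i need that an element of sl(2,C) acting by zero on
    all of X_i vanishes, which is how the conjugate of a curve determines its
    velocity. *)
Require Import Defs.
From mathcomp Require Import all_boot all_order all_algebra.
From mathcomp Require Import generic_quotient complex.
From mathcomp Require Import boolp classical_sets reals.
From mathcomp Require Import topology normedtype derive.
From mathcomp Require Import ring.

Set Implicit Arguments.
Unset Strict Implicit.
Unset Printing Implicit Defensive.

Import Order.TTheory GRing.Theory Num.Theory.
Import numFieldNormedType.Exports.

Local Open Scope complex_scope.
Local Open Scope ring_scope.
Local Open Scope quotient_scope.
Local Open Scope sesquilinear_scope.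

(** * Differentiation at 0 of complex-valued functions of a real variable *)

Section ComplexDerivative.
Variable R : realType.
Implicit Types (f g : R -> R[i]) (u v w : R[i]).

Lemma real_is_derive_ext (f g : R -> R) (d e : R) :
  is_derive (0 : R) 1 f d -> f =1 g -> d = e -> is_derive (0 : R) 1 g e.
Proof. by move=> fd /funext <- <-. Qed.

Lemma is_cderive_ext f g u w :
  is_cderive f u -> f =1 g -> u = w -> is_cderive g w.
Proof. by move=> fu /funext <- <-. Qed.

Lemma is_cderive_unique f u w : is_cderive f u -> is_cderive f w -> u = w.
Proof.
case=> [Ru Iu] [Rw Iw]; case: u w Ru Iu Rw Iw => [a b] [c d] /= Ru Iu Rw Iw.
by rewrite -(@derive_val _ _ _ _ _ _ _ Ru) -(@derive_val _ _ _ _ _ _ _ Iu)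
  (@derive_val _ _ _ _ _ _ _ Rw) (@derive_val _ _ _ _ _ _ _ Iw).
Qed.

Lemma is_cderive_cst w : is_cderive (fun=> w) 0.
Proof. by split; apply: is_derive_cst. Qed.

Lemma is_cderive_real (h : R -> R) (d : R) :
  is_derive (0 : R) 1 h d -> is_cderive (fun t => (h t)%:C) d%:C.
Proof. by move=> hd; split=> //=; apply: is_derive_cst. Qed.

Lemma is_cderive_id : is_cderive (fun t : R => t%:C) 1.
Proof. exact: is_cderive_real. Qed.

Lemma complex_ReD u w : complex.Re (u + w) = complex.Re u + complex.Re w.
Proof. by case: u w => ? ? []. Qed.

Lemma complex_ImD u w : complex.Im (u + w) = complex.Im u + complex.Im w.
Proof. by case: u w => ? ? []. Qed.

Lemma complex_ReM u w : complex.Re (u * w) =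
  complex.Re u * complex.Re w - complex.Im u * complex.Im w.
Proof. by case: u w => ? ? []. Qed.

Lemma complex_ImM u w : complex.Im (u * w) =
  complex.Re u * complex.Im w + complex.Im u * complex.Re w.
Proof. by case: u w => ? ? []. Qed.

Lemma is_cderiveD f g u w :
  is_cderive f u -> is_cderive g w -> is_cderive (fun t => f t + g t) (u + w).
Proof.
move=> [fR fI] [gR gI]; split.
  apply: (real_is_derive_ext (is_deriveD fR gR)); last by rewrite complex_ReD.
  by move=> t; rewrite complex_ReD.
apply: (real_is_derive_ext (is_deriveD fI gI)); last by rewrite complex_ImD.
by move=> t; rewrite complex_ImD.
Qed.

Lemma is_cderiveM f g u w : is_cderive f u -> is_cderive g w ->
  is_cderive (fun t => f t * g t) (u * g 0 + f 0 * w).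
Proof.
move=> [fR fI] [gR gI]; split.
  apply: (real_is_derive_ext (is_deriveB (is_deriveM fR gR) (is_deriveM fI gI))).
    by move=> t; rewrite complex_ReM.
  by rewrite /GRing.scale /= complex_ReD !complex_ReM; ring.
apply: (real_is_derive_ext (is_deriveD (is_deriveM fR gI) (is_deriveM fI gR))).
  by move=> t; rewrite complex_ImM.
by rewrite /GRing.scale /= complex_ImD !complex_ImM; ring.
Qed.

Lemma is_cderiveB f g u w :
  is_cderive f u -> is_cderive g w -> is_cderive (fun t => f t - g t) (u - w).
Proof.
move=> fu gw.
apply: (is_cderive_ext (is_cderiveD fu (is_cderiveM (is_cderive_cst (-1)) gw))).
  by move=> t; rewrite mulN1r.
by rewrite mul0r add0r mulN1r.
Qed.

Lemma is_cderive_conj f u : is_cderive f u -> is_cderive (fun t => (f t)^*) u^*.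
Proof.
move=> [fR fI]; split.
  apply: (real_is_derive_ext fR); last by case: u {fR fI}.
  by move=> t; case: (f t).
apply: (real_is_derive_ext (is_deriveN fI)); last by case: u {fR fI}.
by move=> t; rewrite [RHS](_ : _ = - complex.Im (f t)) //; case: (f t).
Qed.

Lemma real_is_deriveV (h : R -> R) (d : R) : h 0 != 0 ->
  is_derive (0 : R) 1 h d ->
  is_derive (0 : R) 1 (fun t => (h t)^-1) (- d / h 0 ^+ 2).
Proof.
move=> h0 [hv hd]; apply: DeriveDef; first exact: derivableV.
by rewrite deriveV // hd /GRing.scale /= mulrC mulrN mulNr.
Qed.

Lemma normsqE w : (normsq w)%:C = w * w^*.
Proof.
by case: w => a b; apply/eqP; rewrite eq_complex /normsq /=;
  apply/andP; split; apply/eqP; ring.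
Qed.

Lemma ReC_polar u w : (complex.Re (u * w^* + w * u^*))%:C = u * w^* + w * u^*.
Proof.
case: u w => a b [x y]; apply/eqP.
by rewrite eq_complex /=; apply/andP; split; apply/eqP; ring.
Qed.

(** Writing 1 / f as the conjugate of f over |f|^2 leaves only a real function to invert. *)
Lemma is_cderiveV f u : f 0 != 0 -> is_cderive f u ->
  is_cderive (fun t => (f t)^-1) (- u / f 0 ^+ 2).
Proof.
move=> f0 fu.
have cf0 : (f 0)^* != 0 by rewrite conjC_eq0.
have [nsd _] := is_cderiveM fu (is_cderive_conj fu).
set d := complex.Re _ in nsd.
have nd : is_derive (0 : R) 1 (fun t => normsq (f t)) d.
  by apply: (real_is_derive_ext nsd) => // t; rewrite -normsqE.
have n0 : normsq (f 0) != 0 by rewrite normsq_eq0.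
have dE : d%:C = u * (f 0)^* + f 0 * u^*.
  exact: ReC_polar.
apply: (is_cderive_ext (is_cderiveM (is_cderive_conj fu)
   (is_cderive_real (real_is_deriveV n0 nd)))).
  move=> t; rewrite fmorphV /= normsqE.
  (* At a zero of f both sides vanish, since the inverse of 0 is 0. *)
  have [->|ft] := eqVneq (f t) 0; first by rewrite conjC0 !mul0r invr0.
  by rewrite invfM mulrC mulfVK // conjC_eq0.
rewrite fmorph_div rmorphN rmorphXn fmorphV /= normsqE dE.
by field; rewrite f0 cf0.
Qed.

End ComplexDerivative.

(** * Velocities of curves of matrices *)

Section MatrixVelocity.
Variable R : realType.

(** For a curve in SL(2,C) this is [sl2_velocity] up to conversion; allowing all sizes covers
    products, adjoints and column vectors. *)
Definition mx_velocity m n (F : R -> 'M[R[i]]_(m, n)) (V : 'M[R[i]]_(m, n)) :=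
  forall i j, is_cderive (fun t => F t i j) (V i j).

Lemma mx_velocity_ext m n (F G : R -> 'M[R[i]]_(m, n)) V W :
  mx_velocity F V -> F =1 G -> V = W -> mx_velocity G W.
Proof. by move=> FV /funext <- <-. Qed.

Lemma mx_velocity_unique m n (F : R -> 'M[R[i]]_(m, n)) V W :
  mx_velocity F V -> mx_velocity F W -> V = W.
Proof. by move=> FV FW; apply/matrixP => i j; exact: is_cderive_unique. Qed.

Lemma mx_velocity_cst m n (B : 'M[R[i]]_(m, n)) : mx_velocity (fun=> B) 0.
Proof. by move=> i j; rewrite mxE; exact: is_cderive_cst. Qed.

Lemma mx_velocityD m n (F G : R -> 'M[R[i]]_(m, n)) V W :
  mx_velocity F V -> mx_velocity G W ->
  mx_velocity (fun t => F t + G t) (V + W).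
Proof.
move=> FV GW i j.
by apply: (is_cderive_ext (is_cderiveD (FV i j) (GW i j))) => [t|]; rewrite mxE.
Qed.

Lemma mx_velocityM m n p (F : R -> 'M[R[i]]_(m, n)) (G : R -> 'M[R[i]]_(n, p))
    V W : mx_velocity F V -> mx_velocity G W ->
  mx_velocity (fun t => F t *m G t) (V *m G 0 + F 0 *m W).
Proof.
move=> FV GW i k.
have FG := is_cderiveM (FV i _) (GW _ k).
pose d j := V i j * G 0 j k + F 0 i j * W j k.
(* The index enumeration is replaced by an arbitrary list so that induction applies. *)
suff FGs s : is_cderive (fun t => \sum_(j <- s) F t i j * G t j k)
    (\sum_(j <- s) d j).
  apply: (is_cderive_ext (FGs (index_enum 'I_n))) => [t|]; first by rewrite mxE.
  by rewrite !mxE -big_split.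
elim: s => [|j s IHs].
  by apply: (is_cderive_ext (is_cderive_cst 0)) => [t|]; rewrite big_nil.
by apply: (is_cderive_ext (is_cderiveD (FG j j) IHs)) => [t|]; rewrite big_cons.
Qed.

Lemma mx_velocityMl m n p (B : 'M[R[i]]_(m, n)) (G : R -> 'M[R[i]]_(n, p)) W :
  mx_velocity G W -> mx_velocity (fun t => B *m G t) (B *m W).
Proof.
move=> GW; apply: (mx_velocity_ext (mx_velocityM (mx_velocity_cst B) GW)) => //.
by rewrite mul0mx add0r.
Qed.

Lemma mx_velocityMr m n p (F : R -> 'M[R[i]]_(m, n)) (B : 'M[R[i]]_(n, p)) V :
  mx_velocity F V -> mx_velocity (fun t => F t *m B) (V *m B).
Proof.
move=> FV; apply: (mx_velocity_ext (mx_velocityM FV (mx_velocity_cst B))) => //.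
by rewrite mulmx0 addr0.
Qed.

Lemma mx_velocity_adjoint m n (F : R -> 'M[R[i]]_(m, n)) V :
  mx_velocity F V -> mx_velocity (fun t => (F t)^t*) (V^t*).
Proof.
move=> FV i j.
by apply: (is_cderive_ext (is_cderive_conj (FV j i))) => [t|]; rewrite !mxE.
Qed.

Lemma mx_velocity_linear m n (B : 'M[R[i]]_(m, n)) :
  mx_velocity (fun t : R => t%:C *: B) B.
Proof.
move=> i j; have BE := is_cderiveM (@is_cderive_id R) (is_cderive_cst (B i j)).
by apply: (is_cderive_ext BE) => [t|]; rewrite ?mxE // mulr0 addr0 mul1r.
Qed.

End MatrixVelocity.

(** * Algebra of 2 x 2 matrices *)

Section TwoByTwo.

Lemma ord2P (k : 'I_2) : k = 0 \/ k = 1.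
Proof. by case: k => [[|[|//]] ?]; [left|right]; apply: val_inj. Qed.

Lemma sum2E (V : nmodType) (F : 'I_2 -> V) : \sum_i F i = F 0 + F 1.
Proof. by rewrite !big_ord_recl big_ord0 addr0; congr (_ + F _); apply: val_inj. Qed.

Lemma mulmx2E (K : pzSemiRingType) m n (A : 'M[K]_(m, 2)) (B : 'M[K]_(2, n)) i j :
  (A *m B) i j = A i 0 * B 0 j + A i 1 * B 1 j.
Proof. by rewrite mxE sum2E. Qed.

Lemma eq_mx2 (T : Type) (A B : 'M[T]_2) : A 0 0 = B 0 0 -> A 0 1 = B 0 1 ->
  A 1 0 = B 1 0 -> A 1 1 = B 1 1 -> A = B.
Proof.
by move=> *; apply/matrixP => i j; case: (ord2P i) => ->; case: (ord2P j) => ->.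
Qed.

Definition mx22 (T : Type) (a b c d : T) : 'M[T]_2 :=
  \matrix_(i, j) (if i == 0 then if j == 0 then a else b
                  else if j == 0 then c else d).

Lemma mx22E T (a b c d : T) :
  ((mx22 a b c d 0 0 = a) * (mx22 a b c d 0 1 = b)) *
  ((mx22 a b c d 1 0 = c) * (mx22 a b c d 1 1 = d)).
Proof. by rewrite !mxE. Qed.

Lemma tr_mx22 (K : pzRingType) (A : 'M[K]_2) : \tr A = A 0 0 + A 1 1.
Proof. exact: sum2E. Qed.

(* Cayley-Hamilton *)
Lemma invmx_det1 (K : fieldType) (A : 'M[K]_2) :
  \det A = 1 -> invmx A = (\tr A)%:M - A.
Proof.
move=> dA; have uA : A \in unitmx by rewrite unitmxE dA unitr1.
rewrite -[RHS](mulKmx uA) -[LHS]mulmx1; congr (_ *m _).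
have -> : 1%:M = (\det A)%:M :> 'M_2 by rewrite dA.
by apply: eq_mx2; rewrite !(mulmx2E, mxE, tr_mx22, det_mx22) /=; ring.
Qed.

(** As a polynomial in t the determinant is 1 + t tr N + t^2 det N. *)
Lemma det_add1_nilpotent (K : comNzRingType) (t : K) (N : 'M[K]_2) :
  \tr N = 0 -> \det N = 0 -> \det (1%:M + t *: N) = 1.
Proof.
rewrite tr_mx22 !det_mx22 !mxE /= => trN dN.
have -> : (1 + t * N 0 0) * (1 + t * N 1 1) -
    (0 + t * N 0 1) * (0 + t * N 1 0) = 1 + t * (N 0 0 + N 1 1) +
      t ^+ 2 * (N 0 0 * N 1 1 - N 0 1 * N 1 0) by ring.
by rewrite trN dN !mulr0 !addr0.
Qed.

Lemma traceless_nilpotents (K : comNzRingType) (M : 'M[K]_2) : \tr M = 0 ->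
  exists N : 'I_3 -> 'M[K]_2,
    M = N 0 + N 1 + N 2 /\ forall k, \tr (N k) = 0 /\ \det (N k) = 0.
Proof.
rewrite tr_mx22 => trM; pose p := M 0 0.
have M11 : M 1 1 = - p by apply/eqP; rewrite -addr_eq0 addrC trM.
(* The first matrix has both rows equal to (p, - p) and carries the diagonal of M; the two strictly
   triangular ones correct the off-diagonal entries. *)
exists (fun k => if k == 0 then mx22 p (- p) p (- p) else
  if k == 1 then mx22 0 (M 0 1 + p) 0 0 else mx22 0 0 (M 1 0 - p) 0).
split; first by apply: eq_mx2; rewrite !mxE /= ?M11 /p; ring.
move=> k; rewrite tr_mx22 det_mx22.
by case: ifP => _; [|case: ifP => _]; rewrite !mx22E; split; ring.
Qed.

End TwoByTwo.

(** * Curves in SL(2,C) and their inverses *)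

Section SpecialLinear.
Variable R : realType.
Implicit Types A B : SL2 R.

Lemma det_SL2 A : \det (val A) = 1.
Proof. exact/eqP/(valP A). Qed.

Definition mk_SL2 (B : 'M[R[i]]_2) (dB : \det B = 1) : SL2 R :=
  exist (fun B : 'M[R[i]]_2 => \det B == 1) B (introT eqP dB).

(* 1 + t N has determinant 1 for N nilpotent, so writing M as a sum of three
   nilpotents avoids the matrix exponential. *)
Lemma sl2_curve (M : 'M[R[i]]_2) : \tr M = 0 ->
  exists gam : R -> SL2 R, gam 0 = sl2_id R /\ sl2_velocity gam M.
Proof.
case/traceless_nilpotents => N [-> N0].
pose U k (t : R) : 'M[R[i]]_2 := 1%:M + t%:C *: N k.
have dU t : \det (U 0 t *m U 1 t *m U 2 t) = 1.
  by rewrite !det_mulmx !det_add1_nilpotent ?mulr1 //; apply N0.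
have U1 k : U k 0 = 1%:M by rewrite /U scale0r addr0.
have vU k : mx_velocity (U k) (N k).
  apply: (mx_velocity_ext (mx_velocityD (mx_velocity_cst 1%:M)
    (mx_velocity_linear (N k)))) => //.
  by rewrite add0r.
exists (fun t => mk_SL2 (dU t)); split.
  by apply: val_inj; rewrite /= !U1 !mulmx1.
have vUUU := mx_velocityM (mx_velocityM (vU 0) (vU 1)) (vU 2).
by apply: (mx_velocity_ext vUUU) => //; rewrite !U1 !mulmx1 !mul1mx.
Qed.

(** On SL(2,C) inversion coincides with the linear map B -> tr B - B, so the velocity of the inverse
    is tr M - M, wherever the curve is at time 0. *)
Lemma mx_velocity_invmx (gam : R -> SL2 R) (M : 'M[R[i]]_2) :
  \tr M = 0 -> sl2_velocity gam M ->
  mx_velocity (fun t => invmx (val (gam t))) (- M).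
Proof.
rewrite tr_mx22 => trM vM.
have vtr : mx_velocity (fun t => (\tr (val (gam t)))%:M) (0 : 'M[R[i]]_2).
  move=> i j; have [->|ij] := eqVneq i j.
    apply: (is_cderive_ext (is_cderiveD (vM 0 0) (vM 1 1))) => [t|].
      by rewrite tr_mx22 !mxE eqxx.
    by rewrite trM mxE.
  apply: (is_cderive_ext (is_cderive_cst 0)) => [t|]; rewrite !mxE //.
  by rewrite (negbTE ij).
have vN : mx_velocity (fun t => - 1%:M *m val (gam t)) (- M).
  apply: (mx_velocity_ext (mx_velocityMl (- 1%:M) vM)) => //.
  by rewrite mulNmx mul1mx.
apply: (mx_velocity_ext (mx_velocityD vtr vN)); last by rewrite add0r.
by move=> t; rewrite invmx_det1 ?det_SL2 // mulNmx mul1mx.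
Qed.

End SpecialLinear.

(** * Half-space points as Hermitian matrices of determinant 1 *)

Section HermitianModel.
Variable R : realType.
Implicit Types (x y : R[i] * R) (A : 'M[R[i]]_2).

(** For x = (z, t) with t > 0 this is B B^* where B is upper triangular with diagonal (sqrt t, 1 /
    sqrt t) and corner z / sqrt t, an element of SL(2,C) that moves (0, 1) to x. *)
Definition herm_mx x : 'M[R[i]]_2 :=
  (x.2^-1)%:C *: mx22 (x.1 * x.1^* + (x.2 ^+ 2)%:C) x.1 x.1^* 1.

Lemma conjCC (t : R) : (t%:C)^* = t%:C.
Proof. exact: conjc_real. Qed.

Lemma adjoint_mxE m n (B : 'M[R[i]]_(m, n)) i j : B^t* i j = (B j i)^*.
Proof. by rewrite !mxE. Qed.

Lemma adjoint_mul m n p (B : 'M[R[i]]_(m, n)) (C : 'M[R[i]]_(n, p)) :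
  (B *m C)^t* = C^t* *m B^t*.
Proof. by rewrite trmx_mul map_mxM. Qed.

Lemma adjointD m n (B C : 'M[R[i]]_(m, n)) : (B + C)^t* = B^t* + C^t*.
Proof. by rewrite linearD map_mxD. Qed.

Lemma adjointN m n (B : 'M[R[i]]_(m, n)) : (- B)^t* = - B^t*.
Proof. by rewrite linearN map_mxN. Qed.

Lemma adjointZ m n (k : R[i]) (B : 'M[R[i]]_(m, n)) : (k *: B)^t* = k^* *: B^t*.
Proof. by rewrite linearZ map_mxZ. Qed.

Lemma adjoint1 n : (1%:M : 'M[R[i]]_n)^t* = 1%:M.
Proof. by rewrite trmx1 map_mx1. Qed.

Lemma adjoint_inv n (B : 'M[R[i]]_n) : (invmx B)^t* = invmx (B^t*).
Proof. by rewrite trmx_inv map_invmx. Qed.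

Lemma herm_mx_adjoint x : (herm_mx x)^t* = herm_mx x.
Proof.
apply: eq_mx2; rewrite !mxE /= rmorphM /= conjCC ?rmorphD ?rmorphM /=;
  rewrite ?conjCC ?conjCK ?rmorph1 //.
by rewrite [x.1^* * x.1]mulrC.
Qed.

Lemma det_herm_mx x : 0 < x.2 -> \det (herm_mx x) = 1.
Proof.
move=> x0; have xC : x.2%:C != 0 :> R[i] by rewrite fmorph_eq0 gt_eqF.
by rewrite det_mx22 !mxE /= fmorphV rmorphXn /=; field.
Qed.

Lemma herm_mx_unit x : 0 < x.2 -> herm_mx x \in unitmx.
Proof. by move=> x0; rewrite unitmxE det_herm_mx ?unitr1. Qed.

Lemma herm_mxK x : (complex.Re (herm_mx x 1 1))^-1 = x.2.
Proof. by rewrite !mxE /= mulr1 mul0r subr0 invrK. Qed.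

Lemma herm_mx_inj x y : 0 < x.2 -> herm_mx x = herm_mx y -> x = y.
Proof.
case: x y => [z t] [w s] /= t0 E.
have ts : t = s by have := herm_mxK (z, t); rewrite E herm_mxK.
congr pair => //; move/matrixP/(_ 0 1): E; rewrite !mxE /= ts.
by apply/mulfI; rewrite fmorphV invr_eq0 fmorph_eq0 -ts gt_eqF.
Qed.

(* The remaining two entries follow from Hermitian symmetry and the determinant. *)
Lemma hermitian_det_eq (Y Z : 'M[R[i]]_2) : Y^t* = Y -> Z^t* = Z ->
  \det Y = \det Z -> Z 1 1 != 0 -> Y 1 1 = Z 1 1 -> Y 0 1 = Z 0 1 -> Y = Z.
Proof.
move=> hY hZ dYZ Z0 E11 E01.
have E10 : Y 1 0 = Z 1 0 by rewrite -hY -hZ !adjoint_mxE E01.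
apply: eq_mx2 => //; apply: (mulIf Z0).
by move: dYZ; rewrite !det_mx22 E01 E10 E11 => /addIr.
Qed.

(** Both sides are Hermitian of determinant 1, so by [hermitian_det_eq] only the right column has to
    be compared. The lower right entry is the Poincare denominator divided by the height of x. *)
Lemma herm_mx_ext A x : \det A = 1 -> 0 < x.2 -> 0 < poincare_den A x ->
  herm_mx (poincare_ext A x) = A *m herm_mx x *m A^t*.
Proof.
move=> dA x0 d0.
have dE : (poincare_den A x)%:C = (A 1 0 * x.1 + A 1 1) * (A 1 0 * x.1 + A 1 1)^*
    + A 1 0 * (A 1 0)^* * x.2%:C ^+ 2.
  by rewrite /poincare_den rmorphD rmorphM rmorphXn /= !normsqE.
have tC : x.2%:C != 0 :> R[i] by rewrite fmorph_eq0 gt_eqF.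
have dC : (poincare_den A x)%:C != 0 :> R[i] by rewrite fmorph_eq0 gt_eqF.
have E11 : (A *m herm_mx x *m A^t*) 1 1 = (poincare_den A x)%:C / x.2%:C.
  rewrite dE !mulmx2E !adjoint_mxE !mxE /= fmorphV rmorphXn /=.
  by rewrite rmorphD rmorphM /=; field.
apply: hermitian_det_eq; rewrite ?herm_mx_adjoint ?E11 //.
- by rewrite !adjoint_mul trmxCK herm_mx_adjoint mulmxA.
- rewrite !det_mulmx !det_herm_mx ?divr_gt0 // det_map_mx det_tr dA rmorph1.
  by rewrite !mulr1.
- by rewrite mulf_neq0 ?invr_eq0.
- by rewrite !mxE /= fmorphV fmorph_div /= mulr1 invf_div.
- rewrite !mulmx2E !adjoint_mxE !mxE /= !fmorphV fmorph_div /= rmorphXn /=.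
  (* The denominator cancels in the upper right entry, so its expression can be forgotten. *)
  move: (poincare_den A x)%:C x.2%:C dC tC {E11 dE} => d t dC tC.
  by rewrite rmorphD rmorphM /=; field; rewrite dC tC.
Qed.

(** The same reduction to the right column: X Y^-1 X is again Hermitian of determinant 1, and its
    lower right entry is the inverse of the height of the reflected point. *)
Lemma herm_mx_symm x y : 0 < x.2 -> 0 < y.2 ->
  herm_mx (geod_symm x y) = herm_mx x *m invmx (herm_mx y) *m herm_mx x.
Proof.
move=> x0 y0; pose r := normsq (y.1 - x.1) + y.2 ^+ 2.
have rE : r%:C = (y.1 - x.1) * (y.1^* - x.1^*) + y.2%:C ^+ 2.
  by rewrite rmorphD rmorphXn /= normsqE rmorphB.
have r0 : 0 < r by rewrite ltr_wpDl ?normsq_ge0 ?exprn_gt0.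
have rC : r%:C != 0 :> R[i] by rewrite fmorph_eq0 gt_eqF.
have xC : x.2%:C != 0 :> R[i] by rewrite fmorph_eq0 gt_eqF.
have yC : y.2%:C != 0 :> R[i] by rewrite fmorph_eq0 gt_eqF.
have s0 : 0 < (geod_symm x y).2 by rewrite divr_gt0 ?mulr_gt0 ?exprn_gt0.
have E11 : (herm_mx x *m invmx (herm_mx y) *m herm_mx x) 1 1 =
    r%:C / (x.2%:C ^+ 2 * y.2%:C).
  rewrite rE invmx_det1 ?det_herm_mx // !(mulmx2E, tr_mx22, mxE) /=.
  by rewrite !fmorphV !rmorphXn /=; field; rewrite xC yC.
apply: hermitian_det_eq; rewrite ?herm_mx_adjoint ?E11 //.
- by rewrite !adjoint_mul adjoint_inv !herm_mx_adjoint mulmxA.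
- by rewrite !det_mulmx det_inv !det_herm_mx // invr1 !mulr1.
- by rewrite mulf_neq0 ?invr_eq0 ?mulf_neq0 ?expf_neq0.
- by rewrite !mxE /= -/r !fmorphV fmorph_div rmorphM rmorphXn /= mulr1 invf_div.
- rewrite invmx_det1 ?det_herm_mx // !(mulmx2E, tr_mx22, mxE) /= -/r.
  rewrite !fmorphV !fmorph_div !rmorphM /=.
  by rewrite rE in rC *; field; apply/and3P.
Qed.

End HermitianModel.

(** * The Cartan decomposition for hyperbolic space *)

Section HyperbolicSpace.
Variable R : realType.
Implicit Types (x y : H3 R) (A : SL2 R) (M V H : 'M[R[i]]_2).

Local Notation "h %:H" := (herm_mx (val h)) (at level 2, format "h %:H").

Lemma herm_mx_act A y :
  (h3_act (\pi A) y)%:H = val A *m y%:H *m (val A)^t*.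
Proof.
by rewrite val_h3_act herm_mx_ext ?det_SL2 ?poincare_den_gt0 //; exact: (valP y).
Qed.

Lemma invmx_mul n (B C : 'M[R[i]]_n) : B \in unitmx -> C \in unitmx ->
  invmx (B *m C) = invmx C *m invmx B.
Proof.
move=> uB uC; have uBC : B *m C \in unitmx by rewrite unitmx_mul uB.
by rewrite -[RHS](mulKmx uBC) -!mulmxA (mulmxA C) mulmxV // mul1mx mulmxV // mulmx1.
Qed.

Lemma adjoint_unit n (B : 'M[R[i]]_n) : (B^t* \in unitmx) = (B \in unitmx).
Proof. by rewrite map_unitmx unitmx_tr. Qed.

Lemma herm_unit y : y%:H \in unitmx.
Proof. exact/herm_mx_unit/(valP y). Qed.

(* The conjugate of B by the symmetry at x. *)
Definition h3_conj x (B : 'M[R[i]]_2) := x%:H *m invmx (B^t*) *m invmx x%:H.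

Lemma det_h3_conj x A : \det (h3_conj x (val A)) = 1.
Proof.
rewrite /h3_conj !det_mulmx !det_inv det_map_mx det_tr det_SL2 rmorph1.
by rewrite det_herm_mx ?invr1 ?mulr1 //; exact: (valP x).
Qed.

(** Inverting A X Y^-1 X A^* and multiplying by X on both sides gives C Y C^* with C =
    [h3_conj x (val A)], because the adjoint of C is X^-1 A^-1 X. *)
Lemma herm_mx_symm_conj x A y :
  (h3_symm x (h3_act (\pi A) (h3_symm x y)))%:H =
  h3_conj x (val A) *m y%:H *m (h3_conj x (val A))^t*.
Proof.
have x0 := valP x; have uX := herm_unit x; have uY := herm_unit y.
have uA := sl2_unit A; have uA' : (val A)^t* \in unitmx by rewrite adjoint_unit.
have symmE z : (h3_symm x z)%:H = x%:H *m invmx z%:H *m x%:H.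
  by apply: herm_mx_symm => //; exact: (valP z).
rewrite symmE herm_mx_act symmE /h3_conj !adjoint_mul !adjoint_inv trmxCK.
rewrite herm_mx_adjoint !invmx_mul ?unitmx_mul ?unitmx_inv ?uX ?uY ?uA ?uA' //.
by rewrite invmxK !mulmxA.
Qed.

Lemma h3_conj_velocity x (gam : R -> SL2 R) M : \tr M = 0 ->
  sl2_velocity gam M ->
  mx_velocity (fun t => h3_conj x (val (gam t))) (- (x%:H *m M^t* *m invmx x%:H)).
Proof.
move=> trM vM.
have := mx_velocity_adjoint (mx_velocity_invmx trM vM).
move=> /(mx_velocityMl x%:H)/(@mx_velocityMr R) vE.
apply: (mx_velocity_ext (vE _ (invmx x%:H))).
  by move=> t; rewrite adjoint_inv.
by rewrite adjointN mulmxN mulNmx.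
Qed.

Lemma herm_action_velocity (F : R -> 'M[R[i]]_2) (B : 'M[R[i]]_2) V :
  mx_velocity F V ->
  mx_velocity (fun t => F t *m B *m (F t)^t*)
    (V *m B *m (F 0)^t* + F 0 *m B *m V^t*).
Proof.
by move=> FV; apply: mx_velocityM (mx_velocity_adjoint FV); exact: mx_velocityMr.
Qed.

(** Points of height 1 suffice. At (0, 1) the matrix is the identity, which makes K anti-Hermitian;
    the hypothesis then says that K commutes with the matrices of the model, and the points (1, 1)
    and (i, 1) force K to be scalar, hence zero by its trace. *)
Lemma h3_infinitesimally_effective (K : 'M[R[i]]_2) : \tr K = 0 ->
  (forall y, K *m y%:H + y%:H *m K^t* = 0) -> K = 0.
Proof.
rewrite tr_mx22 => trK K0.
pose y (w : R[i]) : H3 R := exist (fun x : R[i] * R => 0 < x.2) (w, 1) ltr01.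
have yE w : (y w)%:H = mx22 (w * w^* + 1) w w^* 1.
  by rewrite /herm_mx /= invr1 expr1n scale1r.
have KK : K^t* = - K.
  have := K0 (y 0); rewrite yE mul0r add0r conjC0.
  have -> : mx22 1 0 0 1 = 1%:M :> 'M[R[i]]_2 by apply: eq_mx2; rewrite !mxE.
  by rewrite mulmx1 mul1mx addrC => /eqP; rewrite addr_eq0 => /eqP.
have {K0} comm w : K *m mx22 (w * w^* + 1) w w^* 1 = mx22 (w * w^* + 1) w w^* 1 *m K.
  by have := K0 (y w); rewrite yE KK mulmxN => /eqP; rewrite subr_eq0 => /eqP.
have comm11 w : K 1 0 * w = w^* * K 0 1.
  have /matrixP/(_ 1 1) := comm w.
  by rewrite !mulmx2E !mx22E mulr1 mul1r => /addIr.
have K1001 : K 1 0 = K 0 1 by have := comm11 1; rewrite conjC1 mul1r mulr1.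
have K01 : K 0 1 = 0.
  have := comm11 'i; rewrite conjCi K1001 mulNr mulrC => /eqP.
  rewrite -addr_eq0 -mulr2n mulrn_eq0 /= mulf_eq0 (negbTE (neq0Ci _)) /=.
  by move/eqP.
have K00 : K 0 0 = 0.
  have /matrixP/(_ 0 1) := comm 1; rewrite !mulmx2E !mx22E K01 !mulr1 mulr0 addr0.
  rewrite add0r mul1r => K0011; move: trK; rewrite -K0011 -mulr2n.
  by move/eqP; rewrite mulrn_eq0 => /eqP.
by apply: eq_mx2; rewrite !mxE ?K1001 //; move: trK; rewrite K00 add0r.
Qed.

(** The curve eta is constrained only through its action. At each point it traces the same orbit
    curve as the explicit conjugate of gam, and infinitesimal effectiveness turns this into equality
    of the velocities. Conversely the explicit conjugate serves as eta. *)
Lemma cartan_m_h3P x M : cartan_m (@h3_act R) (h3_symm x) M <->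
  \tr M = 0 /\ x%:H *m M^t* = M *m x%:H.
Proof.
split=> [[trM [gam [eta [gam0 vgam eta0 veta conj]]]]|[trM MX]]; split=> //.
  have trN : \tr (x%:H *m M^t* *m invmx x%:H) = 0.
    by rewrite mxtrace_mulC mulKmx ?herm_unit // trace_map_mx mxtrace_tr trM rmorph0.
  rewrite scaleN1r in veta.
  (* This is the velocity of eta minus that of the explicit conjugate of gam. *)
  suff : - M + x%:H *m M^t* *m invmx x%:H = 0.
    move/eqP; rewrite addrC subr_eq0 => /eqP/(congr1 (mulmxr x%:H)) /= <-.
    by rewrite mulmxKV ?herm_unit.
  apply: h3_infinitesimally_effective => [|y].
    by rewrite mxtraceD trN addr0 raddfN /= trM oppr0.
  have veY := herm_action_velocity y%:H veta.
  have vsY := herm_action_velocity y%:H (h3_conj_velocity x trM vgam).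
  have s0 : h3_conj x (val (gam 0)) = 1%:M.
    by rewrite gam0 /h3_conj adjoint1 invmx1 mulmx1 mulmxV ?herm_unit.
  have /eqP : (- M) *m y%:H *m (val (eta 0))^t* +
      val (eta 0) *m y%:H *m (- M)^t* =
      - (x%:H *m M^t* *m invmx x%:H) *m y%:H *m (h3_conj x (val (gam 0)))^t* +
      h3_conj x (val (gam 0)) *m y%:H *m (- (x%:H *m M^t* *m invmx x%:H))^t*.
    apply: mx_velocity_unique veY _; apply: (mx_velocity_ext vsY) => // t.
    by rewrite -herm_mx_symm_conj -herm_mx_act conj.
  rewrite s0 eta0 /= adjoint1 !mulmx1 !mul1mx -subr_eq0 => /eqP <-.
  rewrite adjointD !adjointN mulmxDl mulmxDr !mulNmx !mulmxN opprD !opprK.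
  by rewrite addrACA.
have [gam [gam0 vgam]] := sl2_curve trM.
exists gam, (fun t => mk_SL2 (det_h3_conj x (gam t))); split=> //.
- apply: val_inj; rewrite /= gam0 /h3_conj /= adjoint1 invmx1 mulmx1.
  by rewrite mulmxV ?herm_unit.
- apply: (mx_velocity_ext (h3_conj_velocity x trM vgam)) => //.
  by rewrite MX mulmxK ?herm_unit // scaleN1r.
- move=> t y; apply/val_inj/herm_mx_inj; first exact: (valP (h3_act _ _)).
  by rewrite herm_mx_act herm_mx_symm_conj.
Qed.

End HyperbolicSpace.

(** * The isometry for hyperbolic space *)

Section HyperbolicIsometry.
Variable R : realType.
Implicit Types (x y : H3 R) (A : SL2 R) (M V H : 'M[R[i]]_2).

Local Notation "h %:H" := (herm_mx (val h)) (at level 2, format "h %:H").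

(* The differential of herm_mx; that of its inverse, read off from
   t = 1 / Y_11 and z = Y_01 / Y_11, is dherm_inv. *)
Definition dherm (p u : R[i] * R) : 'M[R[i]]_2 :=
  let t := p.2%:C in let s := u.2%:C in
  mx22 ((u.1 * p.1^* + p.1 * u.1^* + 2 * t * s) / t
          - (p.1 * p.1^* + t ^+ 2) * s / t ^+ 2)
    (u.1 / t - p.1 * s / t ^+ 2) (u.1^* / t - p.1^* * s / t ^+ 2)
    (- s / t ^+ 2).

Definition dherm_inv (p : R[i] * R) H : R[i] * R :=
  (p.2%:C * (H 0 1 - p.1 * H 1 1), - p.2 ^+ 2 * complex.Re (H 1 1)).

Lemma h3_pos y : (val y).2%:C != 0 :> R[i].
Proof. by rewrite fmorph_eq0 gt_eqF //; exact: (valP y). Qed.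

Lemma dhermK y : cancel (dherm (val y)) (dherm_inv (val y)).
Proof.
move=> [u s]; have t0 := h3_pos y; congr pair.
  by rewrite !mx22E /=; move: (_%:C) t0 => t t0; field.
have E : - s%:C / (val y).2%:C ^+ 2 = (- s / (val y).2 ^+ 2)%:C :> R[i].
  by rewrite fmorph_div rmorphN rmorphXn.
rewrite mx22E E /=.
by rewrite fmorph_eq0 in t0; field.
Qed.

Lemma real_conj_eq (w : R[i]) : w^* = w -> (complex.Re w)%:C = w.
Proof.
case: w => a b [] /eqP; rewrite eq_sym -addr_eq0 -mulr2n mulrn_eq0 /=.
by move=> /eqP ->.
Qed.

Lemma invmx_herm y : let z := (val y).1 in let t := (val y).2%:C in
  invmx y%:H = t^-1 *: mx22 1 (- z) (- z^*) (z * z^* + t ^+ 2).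
Proof.
move=> z t; have t0 : t != 0 := h3_pos y.
rewrite invmx_det1 ?det_herm_mx //; last exact: (valP y).
by apply: eq_mx2; rewrite !(tr_mx22, mxE) /= fmorphV rmorphXn /= -/t -/z; ring.
Qed.

Lemma trace_invmx_herm y H : \tr (invmx y%:H *m H) =
  (H 0 0 - (val y).1 * H 1 0 - (val y).1^* * H 0 1
   + ((val y).1 * (val y).1^* + (val y).2%:C ^+ 2) * H 1 1) / (val y).2%:C.
Proof.
rewrite invmx_herm -scalemxAl mxtraceZ tr_mx22 !mulmx2E !mx22E.
by move: (val y).2%:C (val y).1 (h3_pos y) => t z t0; field.
Qed.

(** The conditions on H cut out the tangent space of the model, the trace condition being the
    linearization of det Y = 1. It determines the upper left entry, which [dherm_inv] does not
    read. *)
Lemma dherm_invK y H : H^t* = H -> \tr (invmx y%:H *m H) = 0 ->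
  dherm (val y) (dherm_inv (val y) H) = H.
Proof.
move=> hH; rewrite trace_invmx_herm => /eqP.
have t0 := h3_pos y; rewrite mulf_eq0 invr_eq0 (negbTE t0) orbF => /eqP trH.
have H11 : (complex.Re (H 1 1))%:C = H 1 1.
  by apply: real_conj_eq; rewrite -adjoint_mxE hH.
have H10 : (H 0 1)^* = H 1 0 by rewrite -adjoint_mxE hH.
have H11c : (H 1 1)^* = H 1 1 by rewrite -adjoint_mxE hH.
have H00 : H 0 0 = (val y).1 * H 1 0 + (val y).1^* * H 0 1
   - ((val y).1 * (val y).1^* + (val y).2%:C ^+ 2) * H 1 1.
  by apply/eqP; rewrite -subr_eq0 -trH; apply/eqP; ring.
have E2 : (dherm_inv (val y) H).2%:C = - (val y).2%:C ^+ 2 * H 1 1.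
  by rewrite /= rmorphM rmorphN rmorphXn /= H11.
have E1 : (dherm_inv (val y) H).1^* =
    (val y).2%:C * (H 1 0 - (val y).1^* * H 1 1).
  by rewrite rmorphM rmorphB rmorphM /= H10 H11c conjCC.
rewrite /dherm E2 E1 /=; move: (val y).2%:C (val y).1 t0 H00 => t z t0 H00.
by apply: eq_mx2; rewrite mx22E ?H00; field.
Qed.

Lemma dherm_adjoint p u : (dherm p u)^t* = dherm p u.
Proof.
have [t0 s0] : (p.2%:C)^* = p.2%:C :> R[i] /\ (u.2%:C)^* = u.2%:C :> R[i].
  by rewrite !conjCC.
rewrite /dherm; move: p.2%:C u.2%:C t0 s0 => t s t0 s0.
by apply: eq_mx2; rewrite adjoint_mxE !mx22E
  ?(rmorphB, rmorphN, rmorphM, rmorphD, fmorphV, rmorphXn, rmorph_nat) /=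
  ?(t0, s0, conjCK) ?fmorphV ?rmorphXn /= ?t0; ring.
Qed.

Lemma trace_dherm y u : \tr (invmx y%:H *m dherm (val y) u) = 0.
Proof.
rewrite trace_invmx_herm /dherm !mx22E; move: (val y).2%:C (val y).1 (h3_pos y).
by move=> t z t0; field.
Qed.

Lemma invmx_herm_dherm y u :
  let z := (val y).1 in let t := (val y).2%:C in let s := u.2%:C in
  invmx y%:H *m dherm (val y) u =
  t ^- 2 *: mx22 (u.1 * z^* + t * s) u.1
    (t ^+ 2 * u.1^* - z^* ^+ 2 * u.1 - 2 * t * s * z^*) (- (u.1 * z^* + t * s)).
Proof.
move=> z t s; have t0 : t != 0 := h3_pos y.
rewrite invmx_herm /dherm -/z -/t -/s -scalemxAl; move: u.1 s z t t0 => w s0 z0 t1 t0.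
by apply: eq_mx2; rewrite [LHS]mxE mulmx2E [RHS]mxE !mx22E; field.
Qed.

(** The factor 1/2 can be checked at (0, 1): there [dherm] sends (w, s) to the matrix with rows (s,
    w) and (w^*, - s), whose square has trace 2 (|w|^2 + s^2). *)
Lemma h3_metricE y u v : (h3_metric y u v)%:C =
  2^-1 * \tr (invmx y%:H *m dherm (val y) u *m (invmx y%:H *m dherm (val y) v)).
Proof.
have ReP (w1 w2 : R[i]) : (complex.Re (w1 * w2^*))%:C = 2^-1 * (w1 * w2^* + w1^* * w2).
  by rewrite ReJ_add -[conjc _]/(Num.conj _) rmorphM /= conjCK mulrC.
rewrite /h3_metric fmorph_div rmorphD rmorphM rmorphXn /= ReP.
rewrite !invmx_herm_dherm -scalemxAl -scalemxAr !mxtraceZ tr_mx22 !mulmx2E !mx22E.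
move: (val y).2%:C (val y).1 (h3_pos y) u.2%:C v.2%:C u.1 v.1.
by move=> t z t0 s s' w w'; field.
Qed.

(** The quotient rule for Y_01 / Y_11 and 1 / Y_11 brings velocities computed on matrices back to
    half-space coordinates. *)
Lemma h3_velocity_herm (c : R -> H3 R) H :
  mx_velocity (fun t => (c t)%:H) H -> h3_velocity c (dherm_inv (val (c 0)) H).
Proof.
move=> cH; have t0 := h3_pos (c 0); split.
  have c11 : (c 0)%:H 1 1 != 0 by rewrite !mxE /= mulr1 fmorphV invr_eq0.
  apply: (is_cderive_ext (is_cderiveM (cH 0 1) (is_cderiveV c11 (cH 1 1)))).
    move=> t; have ct := h3_pos (c t).
    by rewrite !mxE /= fmorphV mulr1 mulrC mulKf // invr_eq0.
  rewrite !mxE /= fmorphV /=; move: (_%:C) (_.1) t0 => t z t0; field.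
  exact: t0.
have c11 : complex.Re ((c 0)%:H 1 1) != 0.
  by rewrite -invr_eq0 herm_mxK gt_eqF //; exact: (valP (c 0)).
apply: (real_is_derive_ext (real_is_deriveV c11 (cH 1 1).1)) => [t|].
  by rewrite herm_mxK.
by rewrite -exprVn herm_mxK /=; ring.
Qed.

(** The scalar is real because the second summand is conjugate linear. *)
Lemma herm_action_linear (k : R) (B C V W : 'M[R[i]]_2) :
  (k%:C *: V + W) *m C *m B^t* + B *m C *m (k%:C *: V + W)^t* =
  k%:C *: (V *m C *m B^t* + B *m C *m V^t*) + (W *m C *m B^t* + B *m C *m W^t*).
Proof.
rewrite adjointD adjointZ conjCC !mulmxDl mulmxDr -!scalemxAl -scalemxAr.
by rewrite scalerDr addrACA.
Qed.

Lemma mulmx_conj n (M N C : 'M[R[i]]_n) : C \in unitmx ->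
  invmx C *m M *m C *m (invmx C *m N *m C) = invmx C *m (M *m N) *m C.
Proof. by move=> uC; rewrite !mulmxA (mulmxK uC). Qed.

(** Put C = X B^*, so that Y = B C. For V = B M in D_1 the two terms of the differential agree, so
    it equals 2 B M C and Y^-1 carries it to 2 C^-1 M C. Half the trace of a product of two such
    matrices is 2 tr (M N), which is also four times 1/8 of the Killing form. *)
Lemma h3_isometry x A : exists L : 'M[R[i]]_2 -> R[i] * R,
  is_differential (@h3_velocity R) (fun b => h3_act b x) A L /\
  real_linear_isometry (D1 x A)
    (fun V W => 4 * sl2_metric A V W) (h3_metric (h3_act (\pi_(PSL2 R) A) x)) L.
Proof.
pose y := h3_act (\pi A) x; pose B := val A.
have uB : B \in unitmx := sl2_unit A.
have uB' : B^t* \in unitmx by rewrite adjoint_unit.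
have [X XE] : exists X, X = x%:H by exists x%:H.
have uX : X \in unitmx by rewrite XE herm_unit.
have hX : X^t* = X by rewrite XE herm_mx_adjoint.
have [C CE] : exists C, C = X *m B^t* by exists (X *m B^t*).
have uC : C \in unitmx by rewrite CE unitmx_mul uX.
have two0 : (2 : R[i]) != 0 by rewrite pnatr_eq0.
have yE : y%:H = B *m C by rewrite herm_mx_act CE XE mulmxA.
pose dL V := V *m X *m B^t* + B *m X *m V^t*.
have dLD V : D1 x A V -> exists M,
    [/\ \tr M = 0, X *m M^t* = M *m X, V = B *m M & dL V = 2 *: (B *m M *m C)].
  case=> M /cartan_m_h3P[]; rewrite -XE => trM MX <-; exists M; split=> //.
  rewrite /dL adjoint_mul CE -!mulmxA (mulmxA X (M^t*)) MX -!mulmxA.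
  by rewrite -[2]/(1 + 1) scalerDl scale1r.
have yV M : invmx y%:H *m (2 *: (B *m M *m C)) = 2 *: (invmx C *m M *m C).
  by rewrite yE invmx_mul // -scalemxAr !mulmxA mulmxKV.
(* The values of [dL] on D_1 are tangent to the model, so [dherm_inv] loses nothing. *)
have dL_inv V : D1 x A V -> dherm (val y) (dherm_inv (val y) (dL V)) = dL V.
  case/dLD=> M [trM MX -> ->]; apply: dherm_invK.
    rewrite adjointZ conjC_nat CE !adjoint_mul trmxCK hX.
    by rewrite -!mulmxA (mulmxA X) MX -!mulmxA.
  rewrite yV mxtraceZ -mulmxA mxtrace_mulC mulmxK ?trM ?mulr0 //.
exists (fun V => dherm_inv (val y) (dL V)); split.
  move=> gam V gam0 vgam.
  have := herm_action_velocity X vgam; rewrite gam0 -/B -/(dL V) => vE.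
  have := @h3_velocity_herm (fun t => h3_act (\pi_(PSL2 R) (gam t)) x) (dL V).
  rewrite gam0; apply; apply: (mx_velocity_ext vE) => // t.
  by rewrite herm_mx_act XE.
split.
- split; first by [].
    move=> V W /set_mem DV /set_mem DW /(congr1 (dherm (val y))).
    rewrite (dL_inv _ DV) (dL_inv _ DW); have [M [_ _ -> ->]] := dLD _ DV.
    have [N [_ _ -> ->]] := dLD _ DW.
    by move/(scalerI two0)/(can_inj (mulmxK uC)).
  move=> u _; pose H := dherm (val y) u.
  (* The solution of 2 B M C = H. *)
  pose M := 2^-1 *: (invmx B *m H *m invmx C).
  have trM : \tr M = 0.
    rewrite mxtraceZ mxtrace_mulC mulmxA -invmx_mul // -yE trace_dherm mulr0 //.
  (* Membership in m_1 requires M X to be Hermitian, which this form makes visible. *)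
  have MXE : M *m X = 2^-1 *: (invmx B *m H *m invmx (B^t*)).
    by rewrite -scalemxAl CE invmx_mul // !mulmxA (mulmxKV uX).
  have DM : D1 x A (B *m M).
    exists M => //; apply/cartan_m_h3P; rewrite -XE; split=> //.
    have <- : (M *m X)^t* = X *m M^t* by rewrite adjoint_mul hX.
    rewrite MXE adjointZ !adjoint_mul !adjoint_inv trmxCK dherm_adjoint mulmxA.
    by rewrite fmorphV rmorph_nat.
  exists (B *m M) => //; rewrite -[RHS](dhermK y); congr dherm_inv.
  have [N [_ _ /(can_inj (mulKmx uB)) <- ->]] := dLD _ DM.
  rewrite -scalemxAr -scalemxAl scalerA divff // scale1r -[B *m _ *m C]mulmxA.
  by rewrite mulmxKV // mulKVmx.
- move=> k V W _ _.
  have -> : dL (k%:C *: V + W) = k%:C *: dL V + dL W.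
    exact: herm_action_linear.
  move: (dL V) (dL W) => H K.
  rewrite /dherm_inv !mxE; congr pair => /=; first by ring.
  by rewrite complex_ReD complex_ReM /= mul0r subr0; ring.
- move=> V W DV DW; rewrite h3_metricE (dL_inv _ DV) (dL_inv _ DW).
  have [M [_ _ -> ->]] := dLD _ DV; have [N [_ _ -> ->]] := dLD _ DW.
  rewrite !yV /sl2_metric /Kill -/B !mulKmx // -scalemxAl -scalemxAr !mxtraceZ.
  rewrite (mulmx_conj _ _ uC) mxtrace_mulC mulKVmx //.
  by field.
Qed.

End HyperbolicIsometry.

(** * Persistence of nonvanishing near 0 *)

Section NonvanishingNearby.
Variable R : realType.

(** The real function |f|^2 is derivable at 0, hence continuous there. *)
Lemma is_cderive_near_neq0 (f : R -> R[i]) (u : R[i]) :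
  is_cderive f u -> f 0 != 0 -> \forall t \near (0 : R), f t != 0.
Proof.
move=> fu f0; have [+ _] := is_cderiveM fu (is_cderive_conj fu).
set d := complex.Re _ => nd.
have {nd} [nd _] : is_derive (0 : R) 1 (fun t => normsq (f t)) d.
  by apply: (real_is_derive_ext nd) => // t; rewrite -normsqE.
move/derivable1_diffP/differentiable_continuous: nd => nc.
have n0 : normsq (f 0) != 0 by rewrite normsq_eq0.
by apply: filterS (cvgr_neq0 _ nc n0) => t; rewrite normsq_eq0.
Qed.

End NonvanishingNearby.

(** * Lines, representatives and affine charts of the projective line *)

Section ProjectiveLine.
Variable R : realType.
Implicit Types (A : SL2 R) (l m : CP1 R) (v w : 'cV[R[i]]_2) (P : 'M[R[i]]_2).

Lemma cp1_act_mem A l v :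
  v \in val l -> val A *m v \in val (cp1_act (\pi_(PSL2 R) A) l).
Proof.
move=> vl; rewrite val_cp1_act.
by apply/memv_imgP; exists v; rewrite // lfunE.
Qed.

Lemma cp1_eq l m v : v != 0 -> v \in val l -> v \in val m -> l = m.
Proof.
move=> v0 vl vm; apply: val_inj.
by rewrite (cp1_vline v0 vl) (cp1_vline v0 vm).
Qed.

Definition cp1_line v (v0 : v != 0) : CP1 R :=
  exist (fun l : {vspace 'cV[R[i]]_2} => \dim l == 1%N) <[v]>%VS
    (introT eqP (etrans (dim_vline v) (congr1 nat_of_bool v0))).

Lemma mem_cp1_line v (v0 : v != 0) : v \in val (cp1_line v0).
Proof. exact: memv_line. Qed.

(** The scalar relating v to the chosen representative cancels in the ratio, so the chart may be
    computed from any nonzero vector of the line. *)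
Lemma chartP P l v : v != 0 -> v \in val l ->
  chart_dom P l = ((P *m v) 1 0 != 0) /\
  chart P l = (P *m v) 0 0 / (P *m v) 1 0.
Proof.
move=> v0 vl; rewrite /chart_dom /chart.
have := vpick_cp1_neq0 l; have := memv_pick (val l).
rewrite (cp1_vline v0 vl) => /vlineP[k ->]; rewrite scaler_eq0 negb_or.
case/andP=> k0 _; rewrite -scalemxAr !mxE mulf_eq0 (negbTE k0) /=; split=> //.
by rewrite -mulf_div divff ?mul1r.
Qed.

(** The determinant with columns v and w: a collinearity test that can be differentiated along
    curves. *)
Definition wedge v w := v 0 0 * w 1 0 - v 1 0 * w 0 0.

Lemma wedge_cp1 l v w : v \in val l -> w \in val l -> wedge v w = 0.
Proof.
have l0 := vpick_cp1_neq0 l.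
rewrite (cp1_vline l0 (memv_pick _)) => /vlineP[a ->] /vlineP[b ->].
by rewrite /wedge !mxE; ring.
Qed.

Lemma sl2_mul_neq0 A v : v != 0 -> val A *m v != 0.
Proof.
apply: contra => /eqP Av; apply/eqP.
by rewrite -[v](mulKmx (sl2_unit A)) Av mulmx0.
Qed.

Definition cV2 (a b : R[i]) : 'cV[R[i]]_2 := \col_i (if i == 0 then a else b).

Lemma cV2E a b : (cV2 a b 0 0 = a) * (cV2 a b 1 0 = b).
Proof. by rewrite !mxE. Qed.

Lemma cV2_neq0 a b : (a != 0) || (b != 0) -> cV2 a b != 0.
Proof.
apply: contraL => /eqP ab; rewrite negb_or !negbK.
by rewrite -{1}(cV2E a b).1 -{2}(cV2E a b).2 ab !mxE eqxx.
Qed.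

(** Used to complete a point of the projective line to a geodesic. *)
Lemma cp1_other l : exists m, l != m.
Proof.
have e0 : cV2 1 0 != 0 by rewrite cV2_neq0 ?oner_eq0.
have e1 : cV2 0 1 != 0 by rewrite cV2_neq0 ?oner_eq0 ?orbT.
have [->|] := eqVneq l (cp1_line e0); last by exists (cp1_line e0).
exists (cp1_line e1); apply/eqP => E.
have := wedge_cp1 (mem_cp1_line e0); rewrite E => /(_ _ (mem_cp1_line e1)).
rewrite /wedge !cV2E => /eqP.
by rewrite mul0r mulr1 subr0 oner_eq0.
Qed.

End ProjectiveLine.

(** * The Cartan decomposition for the space of geodesics *)

Section GeodesicCartan.
Variable R : realType.
Implicit Types (x y : Geod R) (A : SL2 R) (M V K : 'M[R[i]]_2).

Local Notation half_turn_diag :=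
  (diag_mx (\row_j (if j == 0 then 'i else - 'i)) : 'M[R[i]]_2).

Lemma half_turn_diagE : half_turn_diag = mx22 'i 0 0 (- 'i).
Proof. by apply: eq_mx2; rewrite !mxE. Qed.

(** The eigenvalues i and - i both square to - 1. Hence S^-1 = - S and conjugation by S is B -> - S
    B S, whose - 1 eigenspace is given by S M S = M. *)
Lemma half_turn_mx_sqr x : half_turn_mx x *m half_turn_mx x = - 1%:M.
Proof.
have uE := endpoints_mx_unit x; rewrite /half_turn_mx.
set E := endpoints_mx x in uE *.
rewrite !mulmxA (mulmxKV uE) -(mulmxA E).
have -> : half_turn_diag *m half_turn_diag = - 1%:M.
  rewrite half_turn_diagE; apply: eq_mx2; rewrite mulmx2E !mxE /=;
    by rewrite ?mulrNN ?mulCii; ring.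
by rewrite mulmxN mulNmx mulmx1 mulmxV.
Qed.

(** In the basis of endpoints S is diag (i, - i), and multiplying by it on both sides negates the
    diagonal and keeps the off-diagonal entries. *)
Lemma half_turn_invariantP x M :
  half_turn_mx x *m M *m half_turn_mx x = M <->
  exists q r, M = endpoints_mx x *m mx22 0 q r 0 *m invmx (endpoints_mx x).
Proof.
have uE := endpoints_mx_unit x; rewrite /half_turn_mx.
set E := endpoints_mx x in uE *.
have DKD K : half_turn_diag *m K *m half_turn_diag =
    mx22 (- K 0 0) (K 0 1) (K 1 0) (- K 1 1).
  rewrite half_turn_diagE; have ii := mulCii R[i].
  apply: eq_mx2; rewrite !mulmx2E !mx22E !(mulr0, mul0r, addr0, add0r);
    by rewrite ?(mulrN, mulNr, opprK) mulrAC ii mulN1r ?opprK.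
split=> [HMH|[q [r ->]]].
  pose K := invmx E *m M *m E.
  have ME : M = E *m K *m invmx E by rewrite /K !mulmxA mulmxV // mul1mx mulmxK.
  have KE : half_turn_diag *m K *m half_turn_diag = K.
    by rewrite -[RHS]/(invmx E *m M *m E) -HMH /K !mulmxA mulVmx // mul1mx mulmxKV.
  exists (K 0 1), (K 1 0); rewrite [LHS]ME; congr (_ *m _ *m _).
  have K0 (k : R[i]) : - k = k -> k = 0.
    by move/eqP; rewrite eq_sym -addr_eq0 -mulr2n mulrn_eq0 => /eqP.
  rewrite DKD in KE.
  apply: eq_mx2; rewrite mx22E //; apply: K0.
    by rewrite -[in RHS]KE mx22E.
  by rewrite -[in RHS]KE mx22E.
rewrite !mulmxA (mulmxKV uE) -!(mulmxA E).
rewrite -!mulmxA (mulmxA (invmx E)) mulVmx // mul1mx !mulmxA -!(mulmxA E).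
by rewrite DKD !mx22E oppr0.
Qed.

(** For every v the vectors eta(t) v and S gam(t) S v span the same line. Differentiating their
    wedge at 0 shows that v is an eigenvector of K = S M S - M; a matrix with only eigenvectors is
    scalar, and tr K = 0. *)
Lemma cartan_m_geodP x M : cartan_m (@geod_act R) (geod_symmetry x) M <->
  \tr M = 0 /\ half_turn_mx x *m M *m half_turn_mx x = M.
Proof.
pose hs : SL2 R := exist (fun S : 'M[R[i]]_2 => \det S == 1)
    (half_turn_mx x) (det_half_turn_mx x).
have hsE : half_turn x = \pi_(PSL2 R) hs by [].
set S := half_turn_mx x; have SS : S *m S = - 1%:M := half_turn_mx_sqr x.
split=> [[trM [gam [eta [gam0 vgam eta0 veta conj]]]]|[trM MS]]; split=> //.
  rewrite scaleN1r in veta.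
  have vSS : mx_velocity (fun t => S *m val (gam t) *m S) (S *m M *m S).
    exact: mx_velocityMr (mx_velocityMl S vgam).
  pose K := S *m M *m S - M.
  have KE v : v != 0 -> wedge v (K *m v) = 0.
    (* Conjugacy is stated on geodesics, so the line of v receives an arbitrary second endpoint. *)
    move=> v0; have [m lm] := cp1_other (cp1_line v0).
    pose y : Geod R := exist (fun y : CP1 R * CP1 R => y.1 != y.2) (cp1_line v0, m) lm.
    have W0 t : wedge (val (eta t) *m v) (S *m val (gam t) *m S *m v) = 0.
      pose l := cp1_line v0.
      have lE : cp1_act (\pi_(PSL2 R) (eta t)) l =
          cp1_act (half_turn x) (cp1_act (\pi_(PSL2 R) (gam t))
            (cp1_act (half_turn x) l)).
        exact: (congr1 (fun y : Geod R => (val y).1) (conj t y)).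
      apply: (@wedge_cp1 _ (cp1_act (\pi_(PSL2 R) (eta t)) l)).
        exact/cp1_act_mem/mem_cp1_line.
      rewrite lE -(mulmxA _ S) -(mulmxA S).
      exact: (cp1_act_mem hs (cp1_act_mem (gam t) (cp1_act_mem hs (mem_cp1_line v0)))).
    have ve := mx_velocityMr v veta; have vs := mx_velocityMr v vSS.
    have dW := is_cderiveB (is_cderiveM (ve 0 0) (vs 1 0))
      (is_cderiveM (ve 1 0) (vs 0 0)).
    have := is_cderive_unique (is_cderive_ext dW W0 erefl) (is_cderive_cst 0).
    rewrite gam0 eta0 /= mulmx1 mul1mx SS.
    rewrite /wedge /K mulmxBl !mulNmx mul1mx.
    move: (S *m M *m S *m v) (M *m v) => w z; rewrite !mxE => <-.
    by ring.
  suff : K = 0 by move/eqP; rewrite subr_eq0 => /eqP.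
  have trK : K 0 0 + K 1 1 = 0.
    rewrite -tr_mx22 raddfB /= mxtrace_mulC (mulmxA S S) SS mulNmx mul1mx.
    by rewrite raddfN /= trM oppr0 addr0.
  (* The vectors (1, 0), (0, 1) and (1, 1) successively give K 1 0 = 0, K 0 1 = 0 and K 0 0 = K 1
     1. *)
  have K10 : K 1 0 = 0.
    have := KE (cV2 1 0); rewrite cV2_neq0 ?oner_eq0 // => /(_ isT).
    by rewrite /wedge !mulmx2E !cV2E !mulr1 !mulr0 mul0r mul1r subr0 addr0.
  have K01 : K 0 1 = 0.
    have := KE (cV2 0 1); rewrite cV2_neq0 ?oner_eq0 ?orbT // => /(_ isT).
    rewrite /wedge !mulmx2E !cV2E !mulr1 !mulr0 mul0r mul1r sub0r add0r.
    by move/eqP; rewrite oppr_eq0 => /eqP.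
  have K00 : K 0 0 = 0.
    have := KE (cV2 1 1); rewrite cV2_neq0 ?oner_eq0 // => /(_ isT).
    rewrite /wedge !mulmx2E !cV2E !mulr1 !mul1r K10 K01 addr0 add0r => /eqP.
    rewrite subr_eq0 => /eqP K11; move: trK; rewrite K11 -mulr2n => /eqP.
    by rewrite mulrn_eq0 => /eqP.
  have K11 : K 1 1 = 0 by move: trK; rewrite K00 add0r.
  by apply: eq_mx2; rewrite ?(K00, K01, K10, K11) mxE.
have [gam [gam0 vgam]] := sl2_curve trM.
(* The sign makes the lifted conjugate start at the identity, since S S = - 1. *)
have dS t : \det (- S *m val (gam t) *m S) = 1.
  have dS : \det S = 1 by apply/eqP/det_half_turn_mx.
  rewrite mulNmx mulNmx -scaleN1r detZ sqrrN expr1n mul1r (det_mulmx _ S) (det_mulmx S).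
  by rewrite dS det_SL2 !mulr1.
exists gam, (fun t => mk_SL2 (dS t)); split=> //.
- by apply: val_inj; rewrite /= gam0 /= mulmx1 mulNmx SS opprK.
- apply: (mx_velocity_ext (mx_velocityMr S (mx_velocityMl (- S) vgam))) => //.
  by rewrite !mulNmx MS scaleN1r.
- move=> t y.
  have cp1E l : cp1_act (\pi_(PSL2 R) (mk_SL2 (dS t))) l =
      cp1_act (half_turn x) (cp1_act (\pi_(PSL2 R) (gam t)) (cp1_act (half_turn x) l)).
    have v0 := vpick_cp1_neq0 l; have vl := memv_pick (val l).
    set v := vpick (val l) in v0 vl.
    apply: (@cp1_eq _ _ _ (val hs *m (val (gam t) *m (val hs *m v)))).
    - by rewrite !sl2_mul_neq0.
    (* The lift differs from the triple product by a sign, which preserves the line. *)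
    - rewrite -[_ *m _]opprK memvN.
      have -> : - (val hs *m (val (gam t) *m (val hs *m v))) = val (mk_SL2 (dS t)) *m v.
        by rewrite /= !mulNmx -(mulmxA _ S) -(mulmxA S).
      exact: cp1_act_mem.
    - exact: (cp1_act_mem hs (cp1_act_mem (gam t) (cp1_act_mem hs vl))).
  by apply: val_inj; rewrite /= !cp1E.
Qed.

End GeodesicCartan.

(** * The isometry for the space of geodesics *)

Section GeodesicIsometry.
Variable R : realType.
Implicit Types (x y : Geod R) (A : SL2 R) (P M V K : 'M[R[i]]_2).

Lemma endpoints_mxE x i :
  endpoints_mx x i 0 = vpick (val (val x).1) i 0 /\
  endpoints_mx x i 1 = vpick (val (val x).2) i 0.
Proof.
split; rewrite /endpoints_mx.
  rewrite -[in RHS](row_mxEl _ (vpick (val (val x).2))).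
  by congr (row_mx _ _ _ _); apply: val_inj.
rewrite -[in RHS](row_mxEr (vpick (val (val x).1))).
by congr (row_mx _ _ _ _); apply: val_inj.
Qed.

(* In the chart P the endpoints of A x are the ratios of the columns of P A E, with E
   the matrix of representatives of the endpoints of x. *)
Lemma geod_act_chart P x A :
  let F := P *m val A *m endpoints_mx x in
  let Ax := geod_act (\pi_(PSL2 R) A) x in
  [/\ geod_dom P Ax = (F 1 0 != 0) && (F 1 1 != 0),
      chart P (val Ax).1 = F 0 0 / F 1 0 & chart P (val Ax).2 = F 0 1 / F 1 1].
Proof.
move=> F Ax.
have chartE l : let v := vpick (val l) in
    chart_dom P (cp1_act (\pi_(PSL2 R) A) l) = ((P *m val A *m v) 1 0 != 0) /\
    chart P (cp1_act (\pi_(PSL2 R) A) l) =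
      (P *m val A *m v) 0 0 / (P *m val A *m v) 1 0.
  move=> v; rewrite -mulmxA; apply: chartP.
    exact/sl2_mul_neq0/vpick_cp1_neq0.
  exact/cp1_act_mem/memv_pick.
have F0 i : F i 0 = (P *m val A *m vpick (val (val x).1)) i 0.
  by rewrite /F !(mulmx2E (P *m _)) !(endpoints_mxE x _).1.
have F1 i : F i 1 = (P *m val A *m vpick (val (val x).2)) i 0.
  by rewrite /F !(mulmx2E (P *m _)) !(endpoints_mxE x _).2.
have [d1 c1] := chartE (val x).1; have [d2 c2] := chartE (val x).2.
by rewrite /geod_dom !F0 !F1 -d1 -d2 -c1 -c2.
Qed.

Lemma is_cderive_div (f g : R -> R[i]) (u w : R[i]) : g 0 != 0 ->
  is_cderive f u -> is_cderive g w ->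
  is_cderive (fun t => f t / g t) ((u * g 0 - f 0 * w) / g 0 ^+ 2).
Proof.
move=> g0 fu gw; apply: (is_cderive_ext (is_cderiveM fu (is_cderiveV g0 gw))) => //.
by field.
Qed.

(** With F = P A E and V = A E K E^-1, K antidiagonal with entries q, r, the numerators of the
    quotient rule become - r det F and q det F. Since z1 - z2 = det F / (F 1 0 * F 1 1), everything
    depending on the chart cancels in the metric and leaves 2 (q r' + r q') = 2 tr (K K'). *)
Lemma geod_isometry x A P : P \in unitmx ->
  geod_dom P (geod_act (\pi_(PSL2 R) A) x) ->
  exists L : 'M[R[i]]_2 -> R[i] * R[i],
    is_differential (geod_velocity P) (fun b => geod_act b x) A L /\
    complex_linear_isometry (D2 x A)
      (fun V W => 4 * sl2_metric A V W)
      (geod_metric P (geod_act (\pi_(PSL2 R) A) x)) L.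
Proof.
move=> uP; have uE := endpoints_mx_unit x; have uA := sl2_unit A.
have [-> chart1 chart2] := geod_act_chart P x A.
rewrite /geod_metric chart1 chart2 => {chart1 chart2}.
move EE : (endpoints_mx x) => E; rewrite EE in uE.
pose F := P *m val A *m E.
rewrite -/F => /andP[F10 F11].
have dF : \det F != 0.
  by rewrite -unitfE -unitmxE /F !unitmx_mul uP uA.
pose G V := P *m V *m E.
pose L V : R[i] * R[i] := ((G V 0 0 * F 1 0 - F 0 0 * G V 1 0) / F 1 0 ^+ 2,
  (G V 0 1 * F 1 1 - F 0 1 * G V 1 1) / F 1 1 ^+ 2).
pose W q r := val A *m (E *m mx22 0 q r 0 *m invmx E).
have LW q r : L (W q r) = (- r * \det F / F 1 0 ^+ 2, q * \det F / F 1 1 ^+ 2).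
  have GE : G (W q r) = F *m mx22 0 q r 0.
    by rewrite /G /W /F !mulmxA mulmxKV.
  rewrite /L GE; clearbody F; rewrite det_mx22 !mulmx2E !mx22E.
  by congr (_ / _, _ / _); ring.
have D2P V : D2 x A V <-> exists q r, V = W q r.
  split=> [[M /cartan_m_geodP[_ /half_turn_invariantP[q [r]]]]|[q [r ->]]].
    by rewrite EE => -> <-; exists q, r.
  exists (E *m mx22 0 q r 0 *m invmx E) => //; apply/cartan_m_geodP; split.
    by rewrite mxtrace_mulC mulKmx // tr_mx22 !mx22E addr0.
  by apply/half_turn_invariantP; exists q, r; rewrite EE.
exists L; split.
  move=> gam V gam0 vgam.
  have vF := mx_velocityMr E (mx_velocityMl P vgam).
  have FE : P *m val (gam 0) *m E = F by rewrite gam0.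
  have chartE t := geod_act_chart P x (gam t); rewrite EE in chartE.
  have F10' : (P *m val (gam 0) *m E) 1 0 != 0 by rewrite FE.
  have F11' : (P *m val (gam 0) *m E) 1 1 != 0 by rewrite FE.
  split.
  (* The geodesic stays in the chart because both denominators are nonzero at time 0. *)
  - near=> t; have [-> _ _] := chartE t; apply/andP; split; near: t.
      exact: is_cderive_near_neq0 (vF 1 0) F10'.
    exact: is_cderive_near_neq0 (vF 1 1) F11'.
  - apply: (is_cderive_ext (is_cderive_div F10' (vF 0 0) (vF 1 0))) => [t|].
      by have [_ -> _] := chartE t.
    by rewrite FE.
  - apply: (is_cderive_ext (is_cderive_div F11' (vF 0 1) (vF 1 1))) => [t|].
      by have [_ _ ->] := chartE t.
    by rewrite FE.
split.
- split; first by [].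
    move=> V V' /set_mem/D2P[q [r ->]] /set_mem/D2P[q' [r' ->]].
    rewrite !LW => -[].
    have F10V : F 1 0 ^- 2 != 0 by rewrite invr_eq0 expf_neq0.
    have F11V : F 1 1 ^- 2 != 0 by rewrite invr_eq0 expf_neq0.
    by move=> /(mulIf F10V)/(mulIf dF)/oppr_inj -> /(mulIf F11V)/(mulIf dF) ->.
  (* The values of r and q solve [LW] for the target (u1, u2), one coordinate each. *)
  move=> [u1 u2] _; pose r := - (u1 * F 1 0 ^+ 2 / \det F).
  pose q := u2 * F 1 1 ^+ 2 / \det F.
  exists (W q r); first by apply/D2P; exists q, r.
  by rewrite LW /r /q opprK !divfK ?mulfK ?expf_neq0.
- move=> k V V' _ _; rewrite /L.
  have -> : G (k *: V + V') = k *: G V + G V'.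
    by rewrite /G mulmxDr mulmxDl -scalemxAr -scalemxAl.
  move: (G V) (G V') => H H'; clearbody F.
  by rewrite !mxE; congr pair => /=; field.
- move=> V V' /D2P[q [r ->]] /D2P[q' [r' ->]]; rewrite !LW /sl2_metric /Kill /=.
  rewrite !mulKmx // !mulmxA (mulmxKV uE).
  have -> : \tr (E *m mx22 0 q r 0 *m mx22 0 q' r' 0 *m invmx E) = q * r' + r * q'.
    rewrite mxtrace_mulC !mulmxA mulVmx // mul1mx tr_mx22 !mulmx2E !mx22E.
    by rewrite !mul0r add0r addr0.
  clearbody F; move: dF; rewrite det_mx22 => dF.
  by field; rewrite F10 F11 mulNr.
Unshelve. all: by end_near.
Qed.

End GeodesicIsometry.

(** * The two cases together *)

Theorem proposition5p1 (R : realType) (x1 : H3 R) (x2 : Geod R)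
    (a : PSL2 R) (A : SL2 R) (hA : \pi_(PSL2 R) A = a) :
  (exists L : 'M[R[i]]_2 -> R[i] * R,
     is_differential (@h3_velocity R) (fun b => h3_act b x1) A L /\
     real_linear_isometry (D1 x1 A)
       (fun V W => 4 * sl2_metric A V W) (h3_metric (h3_act a x1)) L) /\
  (forall P : 'M[R[i]]_2, P \in unitmx -> geod_dom P (geod_act a x2) ->
   exists L : 'M[R[i]]_2 -> R[i] * R[i],
     is_differential (geod_velocity P) (fun b => geod_act b x2) A L /\
     complex_linear_isometry (D2 x2 A)
       (fun V W => 4 * sl2_metric A V W)
       (geod_metric P (geod_act a x2)) L).
Proof.
subst a; split; first exact: h3_isometry.
by move=> P uP domP; exact: geod_isometry.
Qed.
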